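(* Let $\mathcal{M}\subset\mathcal{N}$ be a finite set of multi-indices and $C:\mathcal{M}\to\mathbb{R}$. Suppose that there exist correction functions $G^{(\gamma,j)}:\hat\Omega\to\mathbb{R}^d$, defined for $\gamma\in\{1,\dots,N_f\}$ and $j\in\{1,\dots,N_\gamma\}$, such that $H^{(\gamma,j)}:=\nabla\cdot G^{(\gamma,j)}\in\mathcal{V}$ and $$G^{(\gamma,j)}(\hat x^{(\eta,i)})\cdot\hat n^{(\eta)}=\delta_{\gamma\eta}\delta_{ij}\quad\text{for all }\eta\in\{1,\dots,N_f\},\ i\in\{1,\dots,N_\eta\},$$ and satisfying, for all $v\in\mathcal{V}$, $$\int_{\hat\Omega}\Big(G^{(\gamma,j)}(\hat x)\cdot\nabla v(\hat x)-\sum_{\alpha\in\mathcal{M}}\frac{C(\alpha)}{|\hat\Omega|}\,\frac{\partial^{|\alpha|}v(\hat x)}{\partial\hat x_1^{\alpha_1}\cdots\partial\hat x_d^{\alpha_d}}\,\frac{\partial^{|\alpha|}H^{(\gamma,j)}(\hat x)}{\partial\hat x_1^{\alpha_1}\cdots\partial\hat x_d^{\alpha_d}}\Big)\,d\hat x=0 .$$ Let $\{\phi^{(i)}\}_{i=1}^{N_p}$ be an arbitrary basis of $\mathcal{V}$, and suppose that the discrete inner products are of sufficient accuracy that $\langle u,v\rangle_{\mathbf W}=\int_{\hat\Omega}uv\,d\hat x$ and $\langle u,v\rangle_{\mathbf W^{(\gamma)}}=\int_{\hat\Gamma^{(\gamma)}}uv\,d\hat s$ for all $u,v\in\mathcal{V}$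 and all $\gamma\in\{1,\dots,N_f\}$. Define $$\mathbf K:=\sum_{\alpha\in\mathcal{M}}\frac{C(\alpha)}{|\hat\Omega|}(\mathbf D^{(\alpha)})^{T}\mathbf M\,\mathbf D^{(\alpha)},\qquad \mathbf D^{(\alpha)}:=(\mathbf D^{(1)})^{\alpha_1}\cdots(\mathbf D^{(d)})^{\alpha_d},$$ and assume that the coefficients $C(\alpha)$ have been chosen such that $\mathbf M+\mathbf K$ is symmetric positive definite. Then for all $\gamma\in\{1,\dots,N_f\}$ and $j\in\{1,\dots,N_\gamma\}$, $$H^{(\gamma,j)}(\hat x)=\sum_{i=1}^{N_p}L^{(\gamma)}_{ij}\,\phi^{(i)}(\hat x),\qquad\text{where}\qquad \mathbf L^{(\gamma)}:=(\mathbf M+\mathbf K)^{-1}(\mathbf V^{(\gamma)})^{T}\mathbf W^{(\gamma)} .$$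
   Context: $\hat\Omega\subset\mathbb{R}^d$ is a polytope (the reference element) with volume (Lebesgue measure) $|\hat\Omega|$, with flat facets $\hat\Gamma^{(\gamma)}$, $\gamma\in\{1,\dots,N_f\}$, and outward unit normals $\hat n^{(\gamma)}$. $\mathcal{V}$ is the space of real polynomial functions on $\hat\Omega$ spanned by the monomials $\hat x_1^{\alpha_1}\cdots\hat x_d^{\alpha_d}$, $\alpha\in\mathcal{N}$, where $\mathcal{N}\supseteq\{\alpha\in\mathbb{N}_0^d:|\alpha|\le p\}$ is a finite set of $N_p$ multi-indices, $|\alpha|=\alpha_1+\dots+\alpha_d$, $p\in\mathbb{N}_0$; it is assumed that $\mathcal{V}$ is closed under $\partial/\partial\hat x_m$ for each $m\in\{1,\dots,d\}$ and contains the constants. Volume nodes $\hat x^{(i)}\in\hat\Omega$, $i\in\{1,\dots,N\}$ ($N\ge N_p$), and facet nodes $\hat x^{(\gamma,i)}\in\hat\Gamma^{(\gamma)}$, $i\in\{1,\dots,N_\gamma\}$, are given, together with matrices $\mathbf W\in\mathbb{R}^{N\times N}$, $\mathbf W^{(\gamma)}\in\mathbb{R}^{N_\gamma\times N_\gamma}$. The discrete inner products are $\langle u,v\rangle_{\mathbf W}:=\sum_{i,j}u(\hat x^{(i)})W_{ij}v(\hat x^{(j)})$ and $\langle u,v\rangle_{\mathbf W^{(\gamma)}}:=\sum_{i,j}u(\hat x^{(\gamma,i)})W^{(\gamma)}_{ij}v(\hat x^{(\gamma,j)})$. For a basis $\{\phi^{(i)}\}_{i=1}^{N_p}$ of $\mathcal{V}$: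 $V_{ij}:=\phi^{(j)}(\hat x^{(i)})$, $V^{(\gamma)}_{ij}:=\phi^{(j)}(\hat x^{(\gamma,i)})$, $\mathbf M:=\mathbf V^T\mathbf W\mathbf V$, and $\mathbf D^{(m)}\in\mathbb{R}^{N_p\times N_p}$ is the matrix with $\partial\phi^{(j)}/\partial\hat x_m=\sum_{i}D^{(m)}_{ij}\phi^{(i)}$. $\delta$ denotes the Kronecker delta.
   Formalization: Added: each facet inner product is also exact for v and the normal trace G·n, for v in V (automatic if that trace lies in V; the claim fails without it on the unit square, p=0); G is continuous on the polytope and C^1 in its interior; the polytope is convex. *)

(* Defs.v *)
From HB Require Import structures.
From mathcomp Require Import all_boot all_order all_algebra.
From mathcomp Require Import finmap.
From mathcomp Require Import all_classical all_reals all_analysis.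

Set Implicit Arguments.
Unset Strict Implicit.
Unset Printing Implicit Defensive.

Import Order.TTheory GRing.Theory Num.Theory.
Import numFieldNormedType.Exports.

Local Open Scope classical_set_scope.
Local Open Scope ring_scope.

(* R^n is represented by ['rV[R]_n]; its library norm is the sup norm, so Euclidean
   quantities below go through [dot]. *)

Definition measure_matrix_display : measure_display -> measure_display.
Proof. exact. Qed.

Section measurable_matrix.
Context {d} {T : sigmaRingType d}.
Variables m n : nat.

(* The product sigma-algebra: the one generated by the coordinate maps. *)
Definition measurable_mx : set (set 'M[T]_(m, n)) :=
  <<s [set B | exists i j, exists2 A : set T,
        measurable A & B = (fun x : 'M[T]_(m, n) => x i j) @^-1` A] >>.

Let measurable_mx0 : measurable_mx set0.
Proof. exact: sigma_algebra0. Qed.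

Let measurable_mxC A : measurable_mx A -> measurable_mx (~` A).
Proof. exact: sigma_algebraC. Qed.

Let measurable_mx_bigcup (F : (set _)^nat) :
  (forall i, measurable_mx (F i)) -> measurable_mx (\bigcup_i (F i)).
Proof. exact: sigma_algebra_bigcup. Qed.

HB.instance Definition _ := @isMeasurable.Build (measure_matrix_display d)
  'M[T]_(m, n) measurable_mx measurable_mx0 measurable_mxC measurable_mx_bigcup.

End measurable_matrix.

Section lebesgue_rV.
Variable R : realType.

Definition consrV n (vx : 'rV[R]_n * measurableTypeR R) : 'rV[R]_n.+1 :=
  row_mx (vx.2%:M : 'rV[R]_1) vx.1.

Lemma consrV0 n vx : consrV vx ord0 (ord0 : 'I_n.+1) = vx.2.
Proof.
rewrite /consrV (_ : ord0 = lshift n (ord0 : 'I_1)); last exact: val_inj.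
by rewrite (row_mxEl (vx.2%:M : 'rV_1)) mxE eqxx mulr1n.
Qed.

Lemma consrVS n vx (i : 'I_n) : consrV vx ord0 (lift ord0 i) = vx.1 ord0 i.
Proof.
rewrite /consrV (_ : lift ord0 i = rshift 1 i); last exact: val_inj.
by rewrite (row_mxEr (vx.2%:M : 'rV_1)).
Qed.

Lemma measurable_coord n (i : 'I_n) :
  measurable_fun [set: 'rV[R]_n] (fun x => x ord0 i : measurableTypeR R).
Proof.
move=> _ A mA; rewrite setTI; apply: sub_sigma_algebra.
by exists ord0, i, A.
Qed.

Lemma measurable_consrV n : measurable_fun setT (@consrV n).
Proof.
apply: (@measurability _ _ ('rV[R]_n * measurableTypeR R)%type 'rV[R]_n.+1
  _ _ _ erefl) => _ [_ [i [j [A mA ->]] <-]].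
rewrite setTI -comp_preimage (ord1 i).
have [->|[k ->]] : j = ord0 \/ exists k, j = lift ord0 k.
  by case: (unliftP ord0 j) => [k ->|->]; [right; exists k|left].
- rewrite (_ : _ \o _ = snd); last by apply/funext => vx /=; exact: consrV0.
  by rewrite -[X in measurable X]setTI; exact: measurable_snd.
- rewrite (_ : _ \o _ = (fun x : 'rV[R]_n => x ord0 k) \o fst); last first.
    by apply/funext => vx /=; exact: consrVS.
  rewrite -[X in measurable X]setTI.
  by apply: (measurableT_comp (@measurable_coord n k)) => //; exact: measurable_fst.
Qed.

Section step.
Variables (n : nat) (mu : {measure set 'rV[R]_n -> \bar R}).

Definition lebesgue_rV_step : set 'rV[R]_n.+1 -> \bar R :=
  pushforward (mu \x (@lebesgue_measure R))%E (@consrV n).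

Let step0 : lebesgue_rV_step set0 = 0%E.
Proof. by rewrite /lebesgue_rV_step /pushforward preimage_set0 measure0. Qed.

Let step_ge0 A : (0 <= lebesgue_rV_step A)%E.
Proof. exact: (measure_ge0 (mu \x (@lebesgue_measure R))%E). Qed.

Let step_sigma_additive : semi_sigma_additive lebesgue_rV_step.
Proof.
move=> F mF tF mUF; rewrite /lebesgue_rV_step /pushforward preimage_bigcup.
have mp B : measurable B -> measurable (@consrV n @^-1` B).
  by move=> mB; rewrite -[X in measurable X]setTI; exact: measurable_consrV.
apply: measure_semi_sigma_additive.
- by move=> k; exact: mp.
- apply/trivIsetP => /= i j _ _ ij; rewrite -preimage_setI.
  by move/trivIsetP : tF => /(_ _ _ _ _ ij) ->//; rewrite preimage_set0.
- by rewrite -preimage_bigcup; exact: mp.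
Qed.

HB.instance Definition _ := isMeasure.Build _ _ _ lebesgue_rV_step
  step0 step_ge0 step_sigma_additive.

End step.

Fixpoint lebesgue_rV n : {measure set 'rV[R]_n -> \bar R} :=
  match n with
  | 0 => \d_(0 : 'rV[R]_0)
  | n'.+1 => lebesgue_rV_step (lebesgue_rV n')
  end.

(* This property characterizes [lebesgue_rV n]. *)
Lemma lebesgue_rV_box n (A : 'I_n -> set (measurableTypeR R)) :
  (forall i, measurable (A i)) ->
  lebesgue_rV n [set x : 'rV[R]_n | forall i, A i (x ord0 i)] =
  (\prod_(i < n) lebesgue_measure (A i))%E.
Proof.
elim: n A => [|n IH] A mA.
  rewrite big_ord0 /= diracE (_ : _ \in _) // inE /=.
  by case.
have mbox : measurable [set x : 'rV[R]_n | forall i, A (lift ord0 i) (x ord0 i)].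
  rewrite (_ : mkset _ = \bigcap_(i in [set: 'I_n])
      ((fun x : 'rV[R]_n => x ord0 i) @^-1` A (lift ord0 i))).
    apply: fin_bigcap_measurable => // i _.
    by rewrite -[X in measurable X]setTI; exact: measurable_coord.
  by apply/seteqP; split => [x /= xA i _|x xA i]; [exact: xA|exact: (xA i I)].
rewrite big_ord_recl /= /lebesgue_rV_step /pushforward.
rewrite (_ : _ @^-1` _ =
  [set x : 'rV[R]_n | forall i, A (lift ord0 i) (x ord0 i)] `*` A ord0).
  rewrite product_measure1E//.
  by rewrite (IH (fun i => A (lift ord0 i)))// muleC.
apply/seteqP; split => [vx /= xA|vx [/= vA xA] i].
  by split => [i|] /=; [rewrite -consrVS|rewrite -consrV0]; exact: xA.
by case: (unliftP ord0 i) => [k ->|->]; rewrite ?consrVS ?consrV0.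
Qed.

End lebesgue_rV.

Section geometry.
Variables (R : realType) (d : nat).

Definition dot (u v : 'rV[R]_d) : R := \sum_(k < d) u ord0 k * v ord0 k.

Variables (Nf : nat) (nrm : 'I_Nf -> 'rV[R]_d) (b : 'I_Nf -> R).

Definition polytope : set 'rV[R]_d :=
  [set x | forall g, dot (nrm g) x <= b g].

Definition facet (g : 'I_Nf) : set 'rV[R]_d :=
  polytope `&` [set x | dot (nrm g) x = b g].

(* The third clause gives every facet a relative interior point lying on no
   other facet: each [facet g] is (d-1)-dimensional, the facets are pairwise
   distinct, and the polytope has nonempty interior. *)
Definition is_polytope : Prop :=
  [/\ forall g, dot (nrm g) (nrm g) = 1,
      bounded_set polytope &
      forall g, exists2 x, dot (nrm g) x = b g &
                           forall h, h != g -> dot (nrm h) x < b h].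

Definition vol_int (f : 'rV[R]_d -> R) : R :=
  \int[lebesgue_rV R d]_(x in polytope) f x.

Definition volume : R := fine (lebesgue_rV R d polytope).

(* Orthogonal projection onto the hyperplane spanned by facet [g]. *)
Definition foot (g : 'I_Nf) (x : 'rV[R]_d) : 'rV[R]_d :=
  x - (dot (nrm g) x - b g) *: nrm g.

(* The right prism of height 1 erected on facet [g]. *)
Definition prism (g : 'I_Nf) : set 'rV[R]_d :=
  [set x | 0 <= dot (nrm g) x - b g <= 1 /\ facet g (foot g x)].

(* Surface integral over the flat facet [g]: surface measure is the image
   under [foot g] of d-dimensional Lebesgue measure on [prism g], i.e. the
   area of a subset of the facet is the volume of the unit-height right prism
   over it. *)
Definition facet_int (g : 'I_Nf) (f : 'rV[R]_d -> R) : R :=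
  \int[lebesgue_rV R d]_(x in prism g) f (foot g x).

End geometry.

Section polynomials.
Variables (R : realType) (d : nat).
Implicit Types (f v : 'rV[R]_d -> R) (G : 'rV[R]_d -> 'rV[R]_d).

Definition mindex := {ffun 'I_d -> nat}.

Definition mdegree (a : mindex) : nat := (\sum_(k < d) a k)%N.

Definition monomial (a : mindex) (x : 'rV[R]_d) : R :=
  \prod_(k < d) x ord0 k ^+ a k.

(* Polynomial functions on a set with nonempty interior are identified with
   their unique polynomial extension to the whole space. *)
Definition monomial_span (N : {fset mindex}) : set ('rV[R]_d -> R) :=
  [set f | exists c : mindex -> R,
     f = fun x => \sum_(a <- enum_fset N) c a * monomial a x].

Definition is_basis (V : set ('rV[R]_d -> R)) n
    (phi : 'I_n -> 'rV[R]_d -> R) : Prop :=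
  [/\ forall i, V (phi i),
      forall c : 'I_n -> R,
        (fun x => \sum_(i < n) c i * phi i x) = (fun=> 0) ->
        forall i, c i = 0 &
      forall f, V f -> exists c : 'I_n -> R,
        f = fun x => \sum_(i < n) c i * phi i x].

Definition partial (k : 'I_d) f : 'rV[R]_d -> R :=
  fun x => 'D_(delta_mx ord0 k) f x.

Definition mpartial (a : mindex) f : 'rV[R]_d -> R :=
  foldr (fun k g => iter (a k) (partial k) g) f (enum 'I_d).

Definition gradient f (x : 'rV[R]_d) : 'rV[R]_d := \row_k partial k f x.

Definition divergence G (x : 'rV[R]_d) : R :=
  \sum_(k < d) partial k (fun y => G y ord0 k) x.

(* Continuous on [A], continuously differentiable in its interior. *)
Definition C1_field (A : set 'rV[R]_d) G : Prop :=
  [/\ {within A, continuous G},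
      forall x, A° x -> differentiable G x &
      forall k x, A° x ->
        {for x, continuous (fun y => 'D_(delta_mx ord0 k) G y)}].

End polynomials.

Section discretization.
Variables (R : realType) (d : nat).

Definition discrete_ip n (x : 'I_n -> 'rV[R]_d) (W : 'M[R]_n)
    (u v : 'rV[R]_d -> R) : R :=
  \sum_(i < n) \sum_(j < n) u (x i) * W i j * v (x j).

Definition vandermonde n m (x : 'I_n -> 'rV[R]_d)
    (phi : 'I_m -> 'rV[R]_d -> R) : 'M[R]_(n, m) :=
  \matrix_(i < n, j < m) phi j (x i).

Definition mass_mx n m (x : 'I_n -> 'rV[R]_d) (W : 'M[R]_n)
    (phi : 'I_m -> 'rV[R]_d -> R) : 'M[R]_m :=
  (vandermonde x phi)^T *m W *m vandermonde x phi.

(* The ordered product (D 0)^(a 0) * (D 1)^(a 1) * ... of matrix powers. *)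
Definition D_mx m (D : 'I_d -> 'M[R]_m) (a : mindex d) : 'M[R]_m :=
  \prod_(k < d) D k ^+ a k.

Definition K_mx m (vol : R) (Mset : {fset mindex d}) (C : mindex d -> R)
    (M : 'M[R]_m) (D : 'I_d -> 'M[R]_m) : 'M[R]_m :=
  \sum_(a <- enum_fset Mset) (C a / vol) *: ((D_mx D a)^T *m M *m D_mx D a).

Definition sym_posdef m (A : 'M[R]_m) : Prop :=
  A^T = A /\ forall c : 'cV[R]_m, c != 0 -> 0 < (c^T *m A *m c) ord0 ord0.

End discretization.

(* Main.v *)
Require Import Defs.
From mathcomp Require Import all_boot all_order all_algebra.
From mathcomp Require Import finmap.
From mathcomp Require Import all_classical all_reals all_analysis measurable_realfun.
From mathcomp Require Import ring lra.

Set Implicit Arguments.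
Unset Strict Implicit.
Unset Printing Implicit Defensive.

Import Order.TTheory GRing.Theory Num.Theory.
Import numFieldNormedType.Exports.

Local Open Scope classical_set_scope.
Local Open Scope ring_scope.

(** Fix a correction function [G g j], with divergence [H]. For [v] in [V],
    integrating the divergence of [v *: G g j] over the polytope gives

      int v H + int (G g j . grad v) = sum_e int_(facet e) v (G g j . n_e).

    By quadrature accuracy the right-hand side is a sum over the facet nodes, and
    the nodal conditions on [G g j] reduce it to the pairing of the nodal values
    of [v] on facet [g] with column [j] of [Wf g]. The orthogonality condition on
    [G g j] replaces the second integral by the sum over [Mset] of the integrals
    of [mpartial a v * mpartial a H]. In terms of coefficient vectors in the
    basis [phi], where [mpartial a] acts as [D_mx D a] and the volume integrals
    are given by the mass matrix, this says that the coefficient vector [h] of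
    [H] satisfies [(M + K) h = V_g^T W_g e_j]; and [M + K] is invertible because
    it is positive definite.

    The analytic content is the divergence theorem on a polytope
    ([divergence_polytope]), for a field that is continuous up to the boundary
    and continuously differentiable inside only. Its proof uses translation
    invariance of Lebesgue measure and dominated convergence, and neither a
    change of variables nor an iterated integral. The field is multiplied by a
    Lipschitz cutoff that vanishes near the boundary and has slope [1 / eps] in a
    layer of thickness [eps] along each facet. Taking difference quotients under
    the integral moves the derivative from the field to the cutoff
    ([cutoff_by_parts]) and leaves, for each facet, [1 / eps] times the integral
    of the flux over the layer. With [eps = 1 / (N + 1)], the layer and its
    translates along the normal tile a layer of thickness 1 ([Int_layer]), so the
    factor [1 / eps] is absorbed and the limit is the integral over the prism
    that defines the surface integral ([facet_limit]). Facets are separated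
    everywhere except on hyperplanes, which are negligible
    ([hyperplane_negligible]). *)

(** * Translation invariance of Lebesgue measure *)

Section measure.
Context {R : realType}.

Lemma lebesgue_measure_shift (c : R) (A : set (measurableTypeR R)) :
  measurable A -> lebesgue_measure ((fun x => x + c) @^-1` A) = lebesgue_measure A.
Proof.
move=> mA.
have mc : measurable_fun setT (fun x : measurableTypeR R => x + c : measurableTypeR R).
  exact: measurable_funD.
rewrite -[LHS]/(pushforward lebesgue_measure
  ((fun x => x + c) : _ -> measurableTypeR R) A).
apply/esym/lebesgue_measure_unique => // _ [[u v]] _ <- /=.
rewrite /pushforward /=.
rewrite (_ : _ @^-1` _ = [set` `]u - c, v - c]]); last first.
  by apply/seteqP; split => x /=; rewrite !in_itv /= ltrBlDr lerBrDr.
by rewrite !lebesgue_measure_itv /= !lte_fin ltrD2r -!EFinB opprB addrA subrK.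
Qed.

Lemma measurable_rV d (T : measurableType d) (D : set T) n (f : T -> 'rV[R]_n) :
  (forall i, measurable_fun D (fun x => f x ord0 i)) -> measurable_fun D f.
Proof.
move=> mf mD.
apply: (@measurability _ _ T 'rV[R]_n D _ _ erefl) => // _ [_ [i [j [A mA ->]] <-]].
by rewrite (ord1 i); apply: mf.
Qed.

Lemma measurable_shift n (c : 'rV[R]_n) :
  measurable_fun [set: 'rV[R]_n] (fun x => x + c).
Proof.
apply: measurable_rV => i.
rewrite (_ : (fun x => _) = (fun x : 'rV[R]_n => x ord0 i + c ord0 i)); last first.
  by apply/funext => x; rewrite mxE.
by apply: measurable_funD => //; exact: measurable_coord.
Qed.

(** By induction on the dimension: the measure in dimension [n.+1] integrates the
    one-dimensional measure of the sections, and a translation acts separately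
    on the section and on the point at which it is taken. *)
Lemma lebesgue_rV_shift n (c : 'rV[R]_n) (A : set 'rV[R]_n) :
  measurable A -> lebesgue_rV R n ((fun x => x + c) @^-1` A) = lebesgue_rV R n A.
Proof.
elim: n c A => [|n IH] c A mA.
  by congr (_ _); apply/seteqP; split => x /=; rewrite (_ : x + c = x) //;
    apply/rowP => -[].
pose c' : 'rV[R]_n := \row_i c ord0 (lift ord0 i).
pose A' := @consrV R n @^-1` A.
have mA' : measurable A'.
  by rewrite -[A']setTI; exact: measurable_consrV.
rewrite /= /lebesgue_rV_step /pushforward /product_measure1.
transitivity (\int[lebesgue_rV R n]_(x in [set: 'rV[R]_n])
    (lebesgue_measure (xsection A' (x + c')%R)))%E.
  apply: eq_integral => x _ /=.
  rewrite -[RHS](lebesgue_measure_shift (c ord0 ord0)); last first.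
    exact: measurable_xsection.
  congr (_ _); apply/seteqP; split => y /=; rewrite !xsectionE /= /A' /=;
    rewrite (_ : consrV (x, y) + c = consrV (x + c', y + c ord0 ord0)) //;
    apply/rowP => i; rewrite mxE; case: (unliftP ord0 i) => [k ->|->];
    by rewrite ?consrVS ?consrV0 //= !mxE.
have mg : measurable_fun setT (fun x : 'rV[R]_n => lebesgue_measure (xsection A' x)).
  exact: measurable_fun_xsection.
rewrite -[LHS](@ge0_integral_pushforward _ _ _ _ _ (fun x : 'rV[R]_n => x + c' : 'rV[R]_n)
  (measurable_shift c') (lebesgue_rV R n) setT
  (fun x => lebesgue_measure (xsection A' x))) //.
apply: eq_measure_integral => [|? B mB _]; first exact: measurable_shift.
exact: IH.
Qed.

End measure.

(** * Borel sets and bounded sets of row vectors *)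

Section tame.
Context {R : realType}.

Lemma rV_norm_lt n (x : 'rV[R]_n) e :
  0 < e -> (forall i, `|x ord0 i| < e) -> `|x| < e.
Proof.
move=> e0 xe; have [->|x0] := eqVneq `|x| 0; first by [].
have [[i j] /= xij] := mx_norm_neq0 x0.
by rewrite [ltLHS]xij (ord1 i).
Qed.

Lemma rV_coord_le n (x : 'rV[R]_n) i : `|x ord0 i| <= `|x|.
Proof.
rewrite leNgt; apply/negP => h.
have h0 : 0 < `|x ord0 i| by apply: le_lt_trans h.
rewrite [ltLHS]mx_normrE in h.
by move: h; apply/negP; rewrite -leNgt; exact: (le_bigmax _ _ (ord0, i)).
Qed.

(** The sigma-algebra is generated by the coordinates, so openness has to be
    brought back to boxes: an open set is the union of the countably many
    rational boxes that it contains. *)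
Lemma open_rV_measurable n (U : set 'rV[R]_n) : open U -> measurable U.
Proof.
move=> oU.
pose box (qk : {ffun 'I_n -> rat} * nat) : set 'rV[R]_n :=
  [set x | forall i, `|x ord0 i - ratr (qk.1 i)| < qk.2.+1%:R^-1].
have mbox qk : measurable (box qk).
  rewrite (_ : box qk = \bigcap_(i in [set: 'I_n])
      ((fun x : 'rV[R]_n => x ord0 i) @^-1`
         ball (ratr (qk.1 i) : R) qk.2.+1%:R^-1)).
    apply: fin_bigcap_measurable => // i _.
    by rewrite -[X in measurable X]setTI; apply: measurable_coord => //;
      exact: measurable_ball.
  apply/seteqP; split => [x xA i _|x xA i]; first by rewrite /preimage /= /ball /= distrC; exact: xA.
  by have := xA i I; rewrite /= /ball /= distrC.
rewrite (_ : U = \bigcup_(qk in [set: {ffun 'I_n -> rat} * nat])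
    (if `[< box qk `<=` U >] then box qk else set0)); last first.
  apply/seteqP; split => [x Ux|x [qk _]]; last by case: asboolP => // sU xb; exact: sU.
  have /nbhs_ballP[e /= e0 xe] : nbhs x U by exact: open_nbhs_nbhs.
  have [k ke] : exists k : nat, k.+1%:R^-1 < e / 2.
    have [k _ kP] := near_infty_natSinv_lt (PosNum (divr_gt0 e0 (ltr0n _ 2))).
    by exists k; apply: (kP k); rewrite /=.
  have /choice[q qP] : forall i, exists q : rat, `|x ord0 i - ratr q| < k.+1%:R^-1.
    move=> i; have : x ord0 i - k.+1%:R^-1 < x ord0 i + k.+1%:R^-1 :> R.
      by rewrite ltrBlDr -addrA ltrDl addr_gt0.
    move=> /rat_in_itvoo[q]; rewrite in_itv /= => /andP[q1 q2]; exists q.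
    by rewrite distrC ltr_distl q1.
  have xb : box ([ffun i => q i], k) x by move=> i /=; rewrite ffunE.
  exists ([ffun i => q i], k) => //; case: asboolP => // -[] y yb; apply: xe.
  rewrite mx_norm_ball /ball_ /=; apply: rV_norm_lt => // i.
  rewrite !mxE (_ : _ - _ = (x ord0 i - ratr (q i)) - (y ord0 i - ratr (q i))); last first.
    by rewrite opprB addrA subrK.
  apply: (le_lt_trans (ler_normB _ _)); rewrite [ltRHS]splitr ltrD //.
    by apply: lt_trans ke; exact: qP.
  by apply: lt_trans ke; move: (yb i) => /=; rewrite ffunE.
apply: countable_bigcupT_measurable => [|qk]; first exact: countableP.
by case: asboolP.
Qed.

Lemma closed_rV_measurable n (A : set 'rV[R]_n) : closed A -> measurable A.
Proof. by move=> /closed_openC/open_rV_measurable/measurableC; rewrite setCK. Qed.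

Lemma within_continuous_measurable_rV n (A : set 'rV[R]_n) (f : 'rV[R]_n -> R) :
  measurable A -> {within A, continuous f} -> measurable_fun A f.
Proof.
move=> mA cf mA'.
apply: (@measurability _ _ 'rV[R]_n R A f _ (RGenOpens.measurableE R)) => //.
move=> _ [_ [a [b ->] <-]].
have /continuousP/(_ `]a, b[%classic) := cf.
have oab : open (`]a, b[%classic : set R) by exact: interval_open.
move=> /(_ oab)/open_subspaceP [V oV VD]; rewrite setIC -VD.
by apply: measurableI => //; exact: open_rV_measurable.
Qed.

Definition ballset n (r : R) : set 'rV[R]_n := [set x | `|x| <= r].

Lemma measurable_ballset n r : measurable (@ballset n r).
Proof.
apply: closed_rV_measurable.
rewrite (_ : ballset r = (fun x : 'rV[R]_n => `|x|) @^-1` [set y | y <= r]) //.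
by apply: closed_comp; [move=> x _; exact: norm_continuous|exact: closed_le].
Qed.

Lemma ballset_finite n r : (lebesgue_rV R n (ballset r) < +oo)%E.
Proof.
pose box : set 'rV[R]_n := [set x | forall i, `[- r, r]%classic (x ord0 i)].
have mbox : measurable box.
  rewrite (_ : box = \bigcap_(i in [set: 'I_n])
      ((fun x : 'rV[R]_n => x ord0 i) @^-1` `[- r, r]%classic)).
    apply: fin_bigcap_measurable => // i _.
    by rewrite -[X in measurable X]setTI; apply: measurable_coord.
  by apply/seteqP; split => [x xA i _|x xA i]; [exact: xA|exact: (xA i I)].
apply: (@le_lt_trans _ _ (lebesgue_rV R n box)).
  apply: le_measure; rewrite ?inE //; first exact: measurable_ballset.
  move=> x xr i /=; rewrite in_itv /= -ler_norml.
  by apply: le_trans xr; exact: rV_coord_le.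
rewrite (@lebesgue_rV_box _ _ (fun=> `[- r, r]%classic)) //.
rewrite ltey_eq; apply/orP; left.
elim/big_ind: _ => // [x y|i _]; first exact: fin_numM.
by rewrite lebesgue_measure_itv /=; case: ifP.
Qed.

End tame.

(** * Integration of bounded functions with bounded support *)

Section integral.
Context {R : realType} {n : nat}.
Local Notation lam := (lebesgue_rV R n).
Implicit Types (f g : 'rV[R]_n -> R).

Definition bdd_meas f := measurable_fun setT f /\ exists M, forall x, `|f x| <= M.

(** A class of integrable functions stable under sums, translations and products
    with bounded measurable functions. All integrals below are integrals over
    the whole space of such functions, sets being encoded as indicators, so that
    the translation rule [Int_shift] applies without moving the domain. *)
Definition tame f := bdd_meas f /\ exists r, forall x, f x != 0 -> `|x| <= r.

Definition Int f : R := Rintegral lam setT f.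

Lemma tame_integrable f : tame f -> lam.-integrable setT (EFin \o f).
Proof.
move=> [[mf [M fM]] [r fr]].
have M0 : 0 <= M by apply: le_trans (fM 0).
have fE : f = f \_ (ballset r).
  apply/funext => x; rewrite /patch; case: ifPn => // xr.
  by apply/eqP; apply: contraNT xr => /fr xr; rewrite inE.
rewrite fE.
have -> : EFin \o f \_ (ballset r) = (EFin \o f) \_ (ballset r).
  by apply/funext => x; rewrite /patch /=; case: ifP.
apply/(integrable_mkcond _ (@measurable_ballset _ n r)).
have fin : (lam (ballset r) < +oo)%E by exact: ballset_finite.
apply: (le_integrable (@measurable_ballset _ n r) (g := cst M%:E)).
- by apply/measurable_EFinP; exact: measurable_funTS.
- by move=> x _ /=; rewrite lee_fin (ger0_norm M0).
- apply/integrableP; split => //.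
  under eq_integral do rewrite /= ger0_norm //.
  rewrite integral_cst; last exact: measurable_ballset.
  by rewrite ltey_eq fin_numM// ge0_fin_numE.
Qed.

Lemma bdd_measM f g : bdd_meas f -> bdd_meas g -> bdd_meas (fun x => f x * g x).
Proof.
move=> [mf [M fM]] [mg [N gN]]; split; first exact: measurable_funM.
by exists (M * N) => x; rewrite normrM ler_pM.
Qed.

Lemma bdd_measD f g : bdd_meas f -> bdd_meas g -> bdd_meas (fun x => f x + g x).
Proof.
move=> [mf [M fM]] [mg [N gN]]; split; first exact: measurable_funD.
by exists (M + N) => x; rewrite (le_trans (ler_normD _ _)) // lerD.
Qed.

Lemma bdd_meas_cst c : bdd_meas (fun=> c).
Proof. by split => //; exists `|c|. Qed.

Lemma bdd_meas_indic (A : set 'rV[R]_n) : measurable A -> bdd_meas (\1_A).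
Proof.
move=> mA; split; first exact: measurable_indic.
by exists 1 => x; rewrite indicE; case: (_ \in _); rewrite ?normr1 ?normr0.
Qed.

Lemma bdd_meas_shift c f : bdd_meas f -> bdd_meas (fun x => f (x + c)).
Proof.
move=> [mf [M fM]]; split; last by exists M.
exact: (measurableT_comp mf (measurable_shift c)).
Qed.

Lemma tame_bdd f : tame f -> bdd_meas f. Proof. by case. Qed.

Lemma tameMr f g : tame f -> bdd_meas g -> tame (fun x => f x * g x).
Proof.
move=> [bf [r fr]] bg; split; first exact: bdd_measM.
exists r => x fg; apply: fr; apply: contraNneq fg => ->; by rewrite mul0r.
Qed.

Lemma tameMl f g : bdd_meas f -> tame g -> tame (fun x => f x * g x).
Proof.
by move=> bf tg; under eq_fun do rewrite mulrC; exact: tameMr.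
Qed.

Lemma tameZ c f : tame f -> tame (fun x => c * f x).
Proof. by apply: tameMl; exact: bdd_meas_cst. Qed.

Lemma tameD f g : tame f -> tame g -> tame (fun x => f x + g x).
Proof.
move=> [bf [r fr]] [bg [s gs]]; split; first exact: bdd_measD.
exists (Num.max r s) => x fg; rewrite le_max.
have [f0|f0] := eqVneq (f x) 0; last by rewrite fr.
by rewrite gs ?orbT //; apply: contraNneq fg => ->; rewrite f0 addr0.
Qed.

Lemma tame0 : tame (fun=> 0).
Proof. by split; [exact: bdd_meas_cst|exists 0 => x; rewrite eqxx]. Qed.

Lemma tame_sum (J : Type) (s : seq J) (P : pred J) (F : J -> 'rV[R]_n -> R) :
  (forall j, P j -> tame (F j)) -> tame (fun x => \sum_(j <- s | P j) F j x).
Proof.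
move=> tF; elim: s => [|j s IH].
  by under eq_fun do rewrite big_nil; exact: tame0.
under eq_fun do rewrite big_cons.
by case: (boolP (P j)) => // Pj; apply: tameD => //; exact: tF.
Qed.

Lemma tameB f g : tame f -> tame g -> tame (fun x => f x - g x).
Proof.
move=> tf tg; apply: tameD => //.
by have := tameZ (-1) tg; under eq_fun do rewrite mulN1r.
Qed.

Lemma tame_shift c f : tame f -> tame (fun x => f (x + c)).
Proof.
move=> [bf [r fr]]; split; first exact: bdd_meas_shift.
exists (r + `|c|) => x /fr xc; rewrite -(addrK c x).
by rewrite (le_trans (ler_normB _ _)) // lerD2r.
Qed.

Lemma tame_restrict (A : set 'rV[R]_n) f : measurable A -> bounded_set A ->
  measurable_fun A f -> (exists M, forall x, A x -> `|f x| <= M) ->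
  tame (f \_ A).
Proof.
move=> mA [r [_ Ar]] mf [M fM]; split; last first.
  exists (r + 1) => x; rewrite /patch; case: ifPn; rewrite ?eqxx // inE => Ax _.
  by apply: Ar Ax; rewrite ltrDl.
split; first by apply/(measurable_restrictT f mA).
exists `|M| => x; rewrite /patch; case: ifPn; rewrite ?normr0 // inE => Ax.
by apply: le_trans (ler_norm _); exact: fM.
Qed.

Lemma IntD f g : tame f -> tame g -> Int (fun x => f x + g x) = Int f + Int g.
Proof. by move=> tf tg; rewrite /Int RintegralD//; exact: tame_integrable. Qed.

Lemma IntB f g : tame f -> tame g -> Int (fun x => f x - g x) = Int f - Int g.
Proof. by move=> tf tg; rewrite /Int RintegralB//; exact: tame_integrable. Qed.

Lemma IntZ c f : tame f -> Int (fun x => c * f x) = c * Int f.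
Proof. by move=> tf; rewrite /Int RintegralZl//; exact: tame_integrable. Qed.

Lemma Int0 : Int (fun=> 0) = 0.
Proof.
rewrite -[RHS](subrr (Int (fun=> 0))) -(IntB tame0 tame0).
by congr Int; apply/funext => x; rewrite /= subr0.
Qed.

Lemma Int_sum (J : Type) (s : seq J) (P : pred J) (F : J -> 'rV[R]_n -> R) :
  (forall j, P j -> tame (F j)) ->
  Int (fun x => \sum_(j <- s | P j) F j x) = \sum_(j <- s | P j) Int (F j).
Proof.
move=> tF; elim: s => [|j s IH].
  by under eq_fun do rewrite big_nil; rewrite big_nil Int0.
under eq_fun do rewrite big_cons; rewrite big_cons; case: (boolP (P j)) => // Pj.
by rewrite IntD ?IH//; [exact: tF|exact: tame_sum].
Qed.

Lemma Int_shift c f : tame f -> Int (fun x => f (x + c)) = Int f.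
Proof.
move=> tf; rewrite /Int /Rintegral; congr fine.
have mf : measurable_fun setT (EFin \o f) by apply/measurable_EFinP; case: tf => [[]].
transitivity (\int[pushforward lam ((fun x : 'rV[R]_n => x + c : 'rV[R]_n)%R : _ -> 'rV[R]_n)]_x (f x)%:E)%E; last first.
  apply: eq_measure_integral => [|? B mB _]; first exact: measurable_shift.
  exact: lebesgue_rV_shift.
rewrite (integral_pushforward (measurable_shift c) mf) //.
rewrite preimage_setT.
by apply: (tame_integrable (tame_shift c tf)).
Qed.

(** Dominated convergence. Uniform bounds on the values and on the supports
    provide a multiple of the indicator of a ball as the dominating function. *)
Lemma Int_cvg (fs : nat -> 'rV[R]_n -> R) f Z M r :
  (forall k, measurable_fun setT (fs k)) -> measurable_fun setT f ->
  (forall k x, `|fs k x| <= M) -> (forall k x, fs k x != 0 -> `|x| <= r) ->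
  lam.-negligible Z ->
  (forall x, ~ Z x -> fs ^~ x @ \oo --> f x) ->
  Int (fs k) @[k --> \oo] --> Int f.
Proof.
move=> mfs mf fsM fsr nZ fsf.
have M0 : 0 <= M by apply: le_trans (fsM 0 0).
pose g : 'rV[R]_n -> R := fun x => M * \1_(ballset r) x.
have tg : tame g.
  apply: tameZ; split; first by apply: bdd_meas_indic; exact: measurable_ballset.
  exists r => x; rewrite indicE; case: (boolP (x \in _)); rewrite ?inE //.
  by rewrite eqxx.
have [] := @dominated_convergence _ _ R lam setT measurableT
  (fun k => EFin \o fs k) (EFin \o f) (EFin \o g).
- by move=> k; exact/measurable_EFinP.
- exact/measurable_EFinP.
- apply: negligibleS nZ => x /= h; apply: contrapT => Zx; apply: h => _.
  by apply: cvg_EFin; [exact: nearW|exact: fsf].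
- exact: tame_integrable.
- apply: aeW => x k _ /=; rewrite lee_fin /g indicE.
  have [->|/fsr fr] := eqVneq (fs k x) 0.
    by rewrite normr0 mulr_ge0.
  by rewrite mem_set // mulr1.
move=> If _ h; rewrite /Int /Rintegral.
by apply: fine_cvg; rewrite fineK //; exact: integrable_fin_num.
Qed.

End integral.

(** * The dot product and negligible hyperplanes *)

Section dot.
Context {R : realType} {n : nat}.
Local Notation lam := (lebesgue_rV R n).
Implicit Types (u v w x : 'rV[R]_n).

Lemma dotC u v : dot u v = dot v u.
Proof. by apply: eq_bigr => k _; rewrite mulrC. Qed.

Lemma dotDr u v w : dot u (v + w) = dot u v + dot u w.
Proof. by rewrite -big_split; apply: eq_bigr => k _; rewrite mxE mulrDr. Qed.

Lemma dotZr c u v : dot u (c *: v) = c * dot u v.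
Proof. by rewrite mulr_sumr; apply: eq_bigr => k _; rewrite mxE mulrCA. Qed.

Lemma dotBr u v w : dot u (v - w) = dot u v - dot u w.
Proof. by rewrite dotDr -scaleN1r dotZr mulN1r. Qed.

Lemma dotBl u v w : dot (v - w) u = dot v u - dot w u.
Proof. by rewrite dotC dotBr !(dotC u). Qed.

Lemma dotZl c u v : dot (c *: u) v = c * dot u v.
Proof. by rewrite dotC dotZr dotC. Qed.

Lemma dot_ge0 u : 0 <= dot u u.
Proof. by apply: sumr_ge0 => k _; rewrite -expr2 sqr_ge0. Qed.

Lemma dot_eq0 u : (dot u u == 0) = (u == 0).
Proof.
apply/idP/eqP => [|->]; last first.
  by rewrite /dot big1 // => k _; rewrite mxE mul0r.
rewrite psumr_eq0 => [/allP h|k _]; last by rewrite -expr2 sqr_ge0.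
apply/rowP => k; have := h k (mem_index_enum _).
by rewrite mulf_eq0 orbb mxE => /eqP.
Qed.

Lemma dot_delta u k : dot u (delta_mx ord0 k) = u ord0 k.
Proof.
rewrite /dot (bigD1 k) //= big1 ?addr0 ?mxE ?eqxx ?mulr1 //.
by move=> i /negbTE ik; rewrite mxE ik andbF mulr0.
Qed.

Lemma unit_coord_le1 u k : dot u u = 1 -> `|u ord0 k| <= 1.
Proof.
move=> u1; rewrite -(@ler_pXn2r _ 2) ?nnegrE // expr1n real_normK ?num_real //.
rewrite -u1 /dot (bigD1 k) //= -expr2 lerDl sumr_ge0 // => i _.
by rewrite -expr2 sqr_ge0.
Qed.

Lemma continuous_dot u : continuous (dot u).
Proof.
apply: continuous_big => [|i _ x]; first exact: add_continuous.
by apply: continuousM; [exact: cst_continuous|exact: coord_continuous].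
Qed.

Lemma continuous_rV_measurable (f : 'rV[R]_n -> R) :
  continuous f -> measurable_fun setT f.
Proof.
move=> cf; apply: within_continuous_measurable_rV => //.
exact: continuous_subspaceT.
Qed.

Lemma measurable_dot u : measurable_fun setT (dot u).
Proof. by apply: continuous_rV_measurable; exact: continuous_dot. Qed.

Lemma cvg_line (t : nat -> R) u x :
  t j @[j --> \oo] --> 0 -> x + t j *: u @[j --> \oo] --> x.
Proof.
move=> t0; have : x + t j *: u @[j --> \oo] --> x + 0 *: u.
  by apply: cvgD; [exact: cvg_cst|apply: cvgZ => //; exact: cvg_cst].
by rewrite scale0r addr0.
Qed.

Lemma cvg_dot_line (t : nat -> R) u v x :
  t j @[j --> \oo] --> 0 -> dot u (x + t j *: v) @[j --> \oo] --> dot u x.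
Proof.
move=> t0; apply: continuous_cvg; first exact: continuous_dot.
exact: cvg_line.
Qed.

Lemma negligible_exists (J : finType) (F : J -> set 'rV[R]_n) :
  (forall j, lam.-negligible (F j)) -> lam.-negligible [set x | exists j, F j x].
Proof.
move=> nF.
pose G k : set 'rV[R]_n := if choice.unpickle k is Some j then F j else set0.
have nG k : lam.-negligible (G k).
  by rewrite /G; case: (choice.unpickle k) => [j|]; [exact: nF|exact: negligible_set0].
apply: negligibleS (negligible_bigcup nG) => x [j Fx].
by exists (choice.pickle j) => //; rewrite /G choice.pickleK.
Qed.

(** A bounded piece of the hyperplane has the same integral as its translates by
    [-u], [-u/2], [-u/3], etc. These are pairwise disjoint, so their indicators
    tend to 0 everywhere and the common value of the integrals is 0 by dominated
    convergence. *)
Lemma hyperplane_negligible u c : u != 0 ->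
  lam.-negligible [set x | dot u x = c].
Proof.
move=> u0; pose P k := [set x | dot u x = c] `&` @ballset R n k%:R.
suff nP k : lam.-negligible (P k).
  apply: negligibleS (negligible_bigcup nP) => x ux.
  by exists (Num.trunc `|x|).+1 => //; split => //; rewrite /ballset /= ltW // truncnS_gt.
have mP : measurable (P k).
  apply: measurableI; last exact: measurable_ballset.
  rewrite -[X in measurable X]setTI.
  exact: (measurable_dot u measurableT (measurable_set1 c)).
pose f (j : nat) x : R := \1_(P k) (x + harmonic j *: u).
have tP : tame (\1_(P k)).
  split; first exact: bdd_meas_indic.
  exists k%:R => x; rewrite indicE; case: (boolP (x \in _)); rewrite ?eqxx //.
  by rewrite inE => -[].
have fI j : Int (f j) = Int \1_(P k) by exact: Int_shift.
have cf : Int (f j) @[j --> \oo] --> Int (fun _ : 'rV[R]_n => 0).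
  apply: (@Int_cvg _ _ f (fun=> 0) set0 1 (k%:R + `|u|)).
  - by move=> j; case: (tame_shift (harmonic j *: u) tP) => -[].
  - exact: measurable_cst.
  - by move=> j x; rewrite /f indicE; case: (_ \in _); rewrite ?normr1 ?normr0.
  - move=> j x; rewrite /f indicE; case: (boolP (_ \in _)); rewrite ?eqxx //.
    rewrite inE => -[_ /= xk] _; rewrite -(addrK (harmonic j *: u) x).
    apply: (le_trans (ler_normB _ _)); apply: lerD => //.
    rewrite normrZ ger0_norm ?harmonic_ge0 // ler_piMl //.
    by rewrite /harmonic /= invf_le1 // ler1n.
  - exact: negligible_set0.
  - move=> x _; apply: cvg_near_cst.
    have uu : dot u u != 0 by rewrite dot_eq0.
    have [xc|xc] := eqVneq (dot u x) c.
      apply: nearW => j; rewrite /f indicE memNset // => -[/= + _].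
      rewrite dotDr xc dotZr => /eqP; rewrite -subr_eq0 addrAC subrr add0r.
      by rewrite mulf_eq0 (negbTE uu) orbF gt_eqF // harmonic_gt0.
    have : dot u (x + harmonic j *: u) @[j --> \oo] --> dot u x.
      by apply: cvg_dot_line; exact: cvg_harmonic.
    move=> cx; have : dot u (x + harmonic j *: u) - c @[j --> \oo] --> dot u x - c.
      by apply: cvgB => //; exact: cvg_cst.
    move=> /cvgr_neq0; rewrite subr_eq0 => /(_ xc).
    apply: filterS => j; rewrite subr_eq0 => /eqP jc.
    by rewrite /f indicE memNset // => -[].
have I0 : Int \1_(P k) = 0.
  have cc : Int (f j) @[j --> \oo] --> Int (\1_(P k) : _ -> R).
    by under eq_cvg do rewrite fI; exact: cvg_cst.
  by rewrite (cvg_unique _ cc cf) // Int0.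
apply/negligibleP => //; move: I0.
rewrite /Int /Rintegral integral_indic // setIT => /eqP.
rewrite fine_eq0 ?ge0_fin_numE // => [/eqP //|].
apply: le_lt_trans (@ballset_finite R n k%:R).
by apply: le_measure; rewrite ?inE //; [exact: measurable_ballset|apply: subIsetr].
Qed.

End dot.

(** * Layers of small thickness along a unit direction *)

Section layer.
Context {R : realType} {n : nat}.
Variables (u : 'rV[R]_n) (c : R) (N : nat).
Hypothesis u1 : dot u u = 1.
Local Notation m := (N.+1%:R : R).
Let s x := dot u x - c.

(** The half-open slab at signed height between -2/(N+1) and -1/(N+1) over the
    hyperplane [dot u x = c]; the gap of width 1/(N+1) keeps the cutoff below
    supported inside the polytope. *)
Definition layer : set 'rV[R]_n :=
  [set x | - 2 / N.+1%:R <= dot u x - c < - 1 / N.+1%:R].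

Definition unit_layer : set 'rV[R]_n := [set x | 0 <= dot u x - c < 1].

(** The unit layer is cut into N+1 slices of thickness 1/(N+1); each slice is
    translated along [u] onto [layer]. *)
Definition pull_back (x : 'rV[R]_n) : 'rV[R]_n :=
  x - ((Num.truncn (N.+1%:R * (dot u x - c))).+2%:R / N.+1%:R) *: u.

Lemma measurable_slab (a b : R) : measurable [set x | a <= dot u x - c < b].
Proof.
rewrite -[X in measurable X]setTI.
rewrite (_ : [set x | _] = (dot u) @^-1` `[a + c, b + c[).
  exact: (measurable_dot u measurableT).
by apply/seteqP; split => x /=; rewrite in_itv /= lerBrDr ltrBlDr.
Qed.

Lemma layer_shift (j : nat) x :
  layer (x - (j.+2%:R / m) *: u) <-> j%:R <= m * s x < j.+1%:R.
Proof.
have m0 : 0 < m by rewrite ltr0n.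
rewrite /layer /= dotBr dotZr u1 mulr1 addrAC -/(s x).
rewrite ler_pdivrMr // ltr_pdivlMr // mulrBl divfK ?gt_eqF // (mulrC (s x)).
rewrite -(natr1 j.+1) -(natr1 j).
by split => /andP[h1 h2]; apply/andP; split; lra.
Qed.

Lemma pull_backE (q : 'rV[R]_n -> R) x :
  \1_unit_layer x * q (pull_back x) =
  \sum_(j < N.+1) q (x - (j.+2%:R / m) *: u) * \1_layer (x - (j.+2%:R / m) *: u).
Proof.
have m0 : 0 < m by rewrite ltr0n.
have [sx|sx] := pselect (unit_layer x); last first.
  rewrite indicE memNset // mul0r big1 // => j _.
  rewrite indicE memNset ?mulr0 // => /layer_shift /andP[h1 h2]; apply: sx.
  rewrite /unit_layer /= -/(s x); apply/andP; split.
    by rewrite -(pmulr_rge0 _ m0) (le_trans _ h1).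
  by rewrite -(ltr_pM2l m0) mulr1 (lt_le_trans h2) // ler_nat.
have /andP[s0 s1] := sx.
have ms0 : 0 <= m * s x by rewrite mulr_ge0.
have tr := truncn_itv ms0.
have jN : (Num.truncn (m * s x) < N.+1)%N.
  rewrite -(ltr_nat R); case/andP: tr => + _; move=> /le_lt_trans; apply.
  by rewrite -[ltRHS]mulr1 ltr_pM2l.
rewrite (bigD1 (Ordinal jN)) //= [X in _ + X]big1 ?addr0; last first.
  move=> j jj; rewrite indicE memNset ?mulr0 // => /layer_shift /truncn_def h.
  by move/eqP: jj; apply; apply: val_inj.
rewrite !indicE mem_set // mem_set ?mulr1 ?mul1r //.
exact/layer_shift.
Qed.

Lemma tame_pull_back (q : 'rV[R]_n -> R) : tame q ->
  tame (fun x => \1_unit_layer x * q (pull_back x)).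
Proof.
move=> tq; under eq_fun do rewrite pull_backE.
apply: tame_sum => j _.
apply: (@tame_shift _ _ (- _) (fun x => q x * \1_layer x)).
apply: tameMr => //; apply: bdd_meas_indic; exact: measurable_slab.
Qed.

(** Rescaling the integral over a layer of thickness 1/(N+1) to a layer of
    thickness 1, without a change of variables: the N+1 translates of the thin
    layer tile the unit layer, and each contributes the same integral. *)
Lemma Int_layer (q : 'rV[R]_n -> R) : tame q ->
  m * Int (fun x => q x * \1_layer x) =
  Int (fun x => \1_unit_layer x * q (pull_back x)).
Proof.
move=> tq; have tql : tame (fun x => q x * \1_layer x).
  by apply: tameMr => //; apply: bdd_meas_indic; exact: measurable_slab.
under [in RHS]eq_fun do rewrite pull_backE.
rewrite Int_sum => [|j _]; last exact: (tame_shift (- _) tql).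
under eq_bigr do rewrite (Int_shift (- _) tql).
by rewrite sumr_const card_ord -[in RHS]mulr_natl.
Qed.

End layer.

(** * Geometry of the polytope *)

Section polytope_geometry.
Context {R : realType} {d : nat}.
Variables (Nf : nat) (nrm : 'I_Nf -> 'rV[R]_d) (b : 'I_Nf -> R).
Hypothesis hOmega : is_polytope nrm b.
Local Notation lam := (lebesgue_rV R d).
Local Notation Omega := (polytope nrm b).

Let nrm1 e : dot (nrm e) (nrm e) = 1. Proof. by have [->] := hOmega. Qed.

(** For points of the polytope, the distance to the hyperplane of facet [e]. *)
Definition depth e (x : 'rV[R]_d) : R := b e - dot (nrm e) x.

Lemma depthD e x v : depth e (x + v) = depth e x - dot (nrm e) v.
Proof. by rewrite /depth dotDr opprD addrA. Qed.

Lemma depth_ge e x t k :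
  depth e x - `|t| <= depth e (x + t *: delta_mx ord0 k).
Proof.
rewrite depthD dotZr dot_delta lerD2l lerN2 (le_trans (ler_norm _)) // normrM.
by rewrite ler_piMr // unit_coord_le1.
Qed.

Lemma depth_le e x t k :
  depth e (x + t *: delta_mx ord0 k) <= depth e x + `|t|.
Proof.
rewrite depthD dotZr dot_delta lerD2l (le_trans (ler_norm _)) // normrN normrM.
by rewrite ler_piMr // unit_coord_le1.
Qed.

Lemma continuous_depth e : continuous (depth e).
Proof.
by move=> x; apply: continuousB; [exact: cst_continuous|exact: continuous_dot].
Qed.

Lemma measurable_depth e : measurable_fun setT (depth e).
Proof. by apply: continuous_rV_measurable; exact: continuous_depth. Qed.

Lemma polytopeE x : Omega x <-> forall e, 0 <= depth e x.
Proof. by split => h e; have := h e; rewrite ?subr_ge0. Qed.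

Definition deeper r : set 'rV[R]_d := [set x | forall e, r <= depth e x].

Lemma closed_deeper r : closed (deeper r).
Proof.
rewrite (_ : deeper r = \bigcap_e (depth e @^-1` [set y | r <= y])).
  apply: closed_bigI => e _; apply: closed_comp; last exact: closed_ge.
  by move=> x _; exact: continuous_depth.
by apply/seteqP; split => x h e; [move=> _|]; [exact: h|exact: (h e I)].
Qed.

Lemma deeper0 : deeper 0 = Omega.
Proof. by apply/seteqP; split => x /polytopeE. Qed.

Lemma deeper_sub r r' : r' <= r -> deeper r `<=` deeper r'.
Proof. by move=> rr x h e; exact: le_trans (h e). Qed.

Lemma pos_depth_interior x : (forall e, 0 < depth e x) -> Omega° x.
Proof.
move=> xp; rewrite /interior.
have : \forall y \near x, forall e, 0 <= depth e y.
  apply: (@filter_forall _ _ (fun e y => 0 <= depth e y) (nbhs x)) => e.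
  have := @continuous_depth e x.
  by move=> /cvgr_gt /(_ 0 (xp e)); apply: filterS => y /ltW.
by apply: filterS => y; rewrite polytopeE.
Qed.

Lemma deeper_interior r : 0 < r -> deeper r `<=` Omega°.
Proof.
by move=> r0 x xr; apply: pos_depth_interior => e; exact: lt_le_trans (xr e).
Qed.

Lemma bounded_polytope : bounded_set Omega. Proof. by have [] := hOmega. Qed.

Lemma bounded_deeper r : 0 <= r -> bounded_set (deeper r).
Proof.
move=> r0; have [M [Mr MP]] := bounded_polytope; exists M; split => // y My.
by move=> x /(deeper_sub r0); rewrite deeper0; exact: MP.
Qed.

Lemma compact_deeper r : 0 <= r -> compact (deeper r).
Proof.
move=> r0; apply: bounded_closed_compact; first exact: bounded_deeper.
exact: closed_deeper.
Qed.

Lemma measurable_deeper r : measurable (deeper r).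
Proof. by apply: closed_rV_measurable; exact: closed_deeper. Qed.

Lemma measurable_polytope : measurable Omega.
Proof. by rewrite -deeper0; exact: measurable_deeper. Qed.

Lemma compact_polytope : compact Omega.
Proof. by rewrite -deeper0; exact: compact_deeper. Qed.

Lemma tame_restrict_compact (A : set 'rV[R]_d) f :
  compact A -> {within A, continuous f} -> tame (f \_ A : _ -> R).
Proof.
move=> cA cf; have clA : closed A by apply: compact_closed => //; exact: norm_hausdorff.
have mA := closed_rV_measurable clA.
apply: tame_restrict => //; first exact: compact_bounded.
  exact: within_continuous_measurable_rV.
have /compact_bounded[M [_ MP]] := continuous_compact cf cA.
exists (M + 1) => x Ax; apply: (MP (M + 1)); first by rewrite ltrDl.
by exists x.
Qed.

Lemma depth_negligible e c : lam.-negligible [set x | depth e x = c].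
Proof.
have e0 : nrm e != 0 by rewrite -dot_eq0 nrm1 oner_neq0.
apply: negligibleS (hyperplane_negligible (b e - c) e0) => x /= <-.
by rewrite /depth opprB addrC subrK.
Qed.

(** If the two normals differ, the ties form a hyperplane. If they agree, the
    relative interior points of both facets that [is_polytope] provides give
    contradictory strict inequalities between [b e] and [b h]. *)
Lemma tie_negligible e h : e != h ->
  lam.-negligible [set x | depth e x = depth h x].
Proof.
move=> eh; have [E|] := eqVneq (nrm e) (nrm h); last first.
  rewrite -subr_eq0 => /(hyperplane_negligible (b e - b h)).
  apply: negligibleS => x /=; rewrite dotBl /depth => xE.
  by lra.
(* Equal normals: each witness lies strictly inside the other half-space. *)
have [_ _ w] := hOmega.
have [x xe xh] := w e; have [y yh ye] := w h.
have := xh h; rewrite -E xe eq_sym => /(_ eh) beh.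
have := ye e eh; rewrite E yh => bhe.
by have := lt_trans beh bhe; rewrite ltxx.
Qed.

Lemma dot_foot h e x :
  dot (nrm h) (foot nrm b e x) =
  dot (nrm h) x + depth e x * dot (nrm h) (nrm e).
Proof. by rewrite /foot dotBr dotZr /depth -mulNr opprB. Qed.

Lemma depth_foot e x : depth e (foot nrm b e x) = 0.
Proof. by rewrite /depth dot_foot nrm1 /depth; ring. Qed.

Lemma facet_foot e x :
  facet nrm b e (foot nrm b e x) <-> Omega (foot nrm b e x).
Proof.
split => [[]//|fx]; split => //=; have := depth_foot e x.
by rewrite /depth => /eqP; rewrite subr_eq0 => /eqP.
Qed.

(** The condition is affine in [x], with linear part the component of [nrm h]
    orthogonal to [nrm e]. If that component vanishes, the depth is constant on
    the hyperplane of facet [e], and positive at a relative interior point of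
    that facet. *)
Lemma edge_negligible e h : h != e ->
  lam.-negligible [set x | depth h (foot nrm b e x) = 0].
Proof.
move=> he; pose m := nrm h - dot (nrm h) (nrm e) *: nrm e.
have mE x : dot (nrm h) (foot nrm b e x) =
    dot m x + b e * dot (nrm h) (nrm e).
  by rewrite dot_foot /depth dotBl dotZl; ring.
have [m0|m0] := eqVneq m 0; last first.
  apply: negligibleS (hyperplane_negligible (b h - b e * dot (nrm h) (nrm e)) m0).
  by move=> x /=; rewrite /depth mE => h0; lra.
have [_ _ /(_ e)[y ye /(_ h he)]] := hOmega.
have yE : dot (nrm h) y = b e * dot (nrm h) (nrm e).
  have /eqP := m0; rewrite subr_eq0 => /eqP {1}->.
  by rewrite dotZl ye mulrC.
rewrite yE => lt_bh; apply: negligibleS (negligible_set0 lam) => x /=.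
rewrite /depth mE m0 /dot big1 => [|k _]; last by rewrite mxE mul0r.
by rewrite add0r => /eqP; rewrite subr_eq0 gt_eqF.
Qed.

End polytope_geometry.

(** * Surface integrals as limits of thin layers *)

Section facet_limit.
Context {R : realType} {d : nat}.
Variables (Nf : nat) (nrm : 'I_Nf -> 'rV[R]_d) (b : 'I_Nf -> R).
Hypothesis hOmega : is_polytope nrm b.
Local Notation lam := (lebesgue_rV R d).
Local Notation Omega := (polytope nrm b).
Local Notation depth := (depth nrm b).
Local Notation foot := (foot nrm b).

Let nrm1 e : dot (nrm e) (nrm e) = 1. Proof. by have [->] := hOmega. Qed.

(** The part of the layer at depth between [eps] and [2 * eps] that is closest to
    facet [e]: there the cutoff depends on [depth e] only. *)
Definition facet_layer e (eps : R) : set 'rV[R]_d :=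
  [set x | eps < depth e x <= 2 * eps /\ forall h, h != e -> depth e x < depth h x].

Lemma facet_layer_polytope e eps : 0 < eps -> facet_layer e eps `<=` Omega.
Proof.
move=> e0 x [/andP[xe _] xh]; apply/polytopeE => h.
have [->|/xh he] := eqVneq h e; apply: ltW; first exact: lt_trans xe.
exact: lt_trans (lt_trans e0 xe) he.
Qed.

Lemma measurable_facet_layer e eps : measurable (facet_layer e eps).
Proof.
rewrite (_ : facet_layer e eps = (depth e @^-1` `]eps, 2 * eps]) `&`
   \bigcap_(h in [set h | h != e]) ((fun x => depth h x - depth e x) @^-1` `]0, +oo[)).
  apply: measurableI.
    rewrite -[X in measurable X]setTI.
    exact: (measurable_depth nrm b e measurableT).
  apply: fin_bigcap_measurable => [|h _]; first exact: finite_finset.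
  rewrite -[X in measurable X]setTI.
  exact: (measurable_funB (measurable_depth nrm b h) (measurable_depth nrm b e)
            measurableT).
apply/seteqP; split => x [xe xh]; split.
- by rewrite /= in_itv.
- by move=> h /= /xh; rewrite in_itv /= andbT subr_gt0.
- by move: xe; rewrite /= in_itv.
- by move=> h /xh; rewrite /= in_itv /= andbT subr_gt0.
Qed.

Lemma facet_layer_layer e N :
  facet_layer e N.+1%:R^-1 `<=` layer (nrm e) (b e) N.
Proof.
move=> x [/andP[h1 h2] _]; rewrite /layer /=; move: h1 h2; rewrite /depth.
by set i := N.+1%:R^-1 => h1 h2; apply/andP; split; lra.
Qed.

(** Pulling a point back from the unit layer leaves it just below its foot on the
    hyperplane, at a displacement [t] that tends to 0. *)
Lemma pull_back_foot e N x : unit_layer (nrm e) (b e) x ->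
  exists2 t, pull_back (nrm e) (b e) N x = foot e x + t *: nrm e &
    - (2 * N.+1%:R^-1) <= t < - N.+1%:R^-1.
Proof.
move=> /andP[s0 s1]; set s := dot _ x - b e in s0 s1.
have m0 : 0 < N.+1%:R :> R by rewrite ltr0n.
exists (s - (Num.truncn (N.+1%:R * s)).+2%:R / N.+1%:R).
  by rewrite /pull_back /foot -/s (scalerBl s) addrA subrK.
have /truncn_itv : 0 <= N.+1%:R * s by rewrite mulr_ge0.
set k := Num.truncn _ => /andP[k1 k2].
have -> : s - k.+2%:R / N.+1%:R = (N.+1%:R * s - k.+2%:R) / N.+1%:R.
  by rewrite mulrBl (mulrC _ s) mulfK // gt_eqF.
rewrite ler_pdivlMr // ltr_pdivrMr // !mulNr -mulrA mulVf ?gt_eqF // mulr1.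
by move: k1 k2; rewrite -(natr1 k.+1) -(natr1 k) => k1 k2; apply/andP; split; lra.
Qed.

(** After rescaling the layer to the unit layer by [Int_layer], the integrand is
    evaluated at points that converge to the foot of [x], so dominated
    convergence gives the integral over the prism. A point whose foot is in the
    relative interior of the facet is eventually pulled back into
    [facet_layer]; one whose foot is off the facet eventually leaves it; the
    feet on the relative boundary of the facet are negligible. *)
Lemma facet_limit e (q : 'rV[R]_d -> R) : {within Omega, continuous q} ->
  N.+1%:R * Int (fun x => (q \_ Omega) x * \1_(facet_layer e N.+1%:R^-1) x)
    @[N --> \oo] --> facet_int nrm b e q.
Proof.
move=> cq.
have tq : tame (q \_ Omega).
  by apply: tame_restrict_compact => //; exact: compact_polytope.
pose Q N x := (q \_ Omega) x * \1_(facet_layer e N.+1%:R^-1) x.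
have tQ N : tame (Q N).
  by apply: tameMr => //; apply: bdd_meas_indic; exact: measurable_facet_layer.
pose P N x := \1_(unit_layer (nrm e) (b e)) x * Q N (pull_back (nrm e) (b e) N x).
have E N : N.+1%:R * Int (Q N) = Int (P N).
  rewrite -Int_layer//; congr (_ * Int _); apply/funext => x.
  rewrite /Q !indicE; case: (boolP (x \in facet_layer _ _)); rewrite ?mulr0 ?mul0r //.
  by rewrite inE => /facet_layer_layer/mem_set ->; rewrite !mulr1.
under eq_cvg do rewrite E.
have mfoot : measurable_fun setT (foot e).
  apply: measurable_rV => i.
  rewrite (_ : (fun x => _) = (fun x : 'rV[R]_d => x ord0 i -
      (dot (nrm e) x - b e) * nrm e ord0 i)); last first.
    by apply/funext => x; rewrite !mxE.
  apply: measurable_funB; first exact: measurable_coord.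
  apply: measurable_funM => //; apply: measurable_funB => //.
  exact: measurable_dot.
have mprism : measurable (prism nrm b e).
  rewrite (_ : prism nrm b e = ((dot (nrm e)) @^-1` `[b e, b e + 1]) `&`
     (foot e @^-1` Omega)).
    apply: measurableI; rewrite -[X in measurable X]setTI.
      exact: (measurable_dot (nrm e) measurableT).
    by apply: mfoot => //; exact: measurable_polytope.
  apply/seteqP; split => x [/= s01 xf]; split => //=.
  - by move: s01; rewrite in_itv /= subr_ge0 lerBlDl.
  - by case: xf.
  - by move: s01; rewrite in_itv /= subr_ge0 lerBlDl.
  - exact/facet_foot.
have -> : facet_int nrm b e q = Int ((fun x => q (foot e x)) \_ (prism nrm b e)).
  by rewrite /facet_int /Int Rintegral_mkcond.
have [_ [M QM]] : bdd_meas (q \_ Omega) by exact: tame_bdd.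
have [_ [r qr]] := tq.
pose Z := [set x | depth e x = - 1] `|`
  [set x | exists h, h != e /\ depth h (foot e x) = 0].
have QM' N x : `|Q N x| <= M.
  have M0 : 0 <= M by apply: le_trans (QM x).
  rewrite /Q normrM indicE; case: (_ \in _); rewrite ?normr0 ?mulr0 //.
  by rewrite normr1 mulr1.
apply: (@Int_cvg _ _ P _ Z M (r + 3 * `|nrm e|)).
- by move=> N; case: (tame_pull_back (b e) N (nrm1 e) (tQ N)) => -[].
- apply/(measurable_restrictT _ mprism).
  apply: (eq_measurable_fun ((q \_ Omega) \o foot e)).
    move=> x; rewrite inE => -[_ [fO _]] /=.
    by rewrite /patch mem_set.
  apply: measurable_funTS; apply: measurableT_comp mfoot.
  by case: tq => -[].
- move=> N x; rewrite /P indicE; case: (_ \in _); rewrite ?mul1r //.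
  by rewrite mul0r normr0 (le_trans _ (QM x)).
- move=> N x; rewrite /P indicE; case: (boolP (x \in _)); rewrite ?mul0r ?eqxx // inE mul1r => ux.
  have [t pb /andP[t1 t2]] := pull_back_foot N ux.
  move=> Qx; have qx : `|pull_back (nrm e) (b e) N x| <= r.
    by apply: qr; apply: contraNneq Qx; rewrite /Q => ->; rewrite mul0r.
  have -> : x = pull_back (nrm e) (b e) N x +
     (dot (nrm e) x - b e - t) *: nrm e.
    rewrite pb /foot; set s := _ - b e.
    by rewrite (scalerBl s) addrA addrAC addrK subrK.
  rewrite (le_trans (ler_normD _ _)) // lerD // normrZ ler_wpM2r //.
  have N1 : N.+1%:R^-1 <= 1 :> R by rewrite invf_le1 ?ler1n.
  have N0 : 0 < N.+1%:R^-1 :> R by rewrite invr_gt0.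
  case/andP: ux => u0 u1; move: t1 t2 N1 N0; set i := N.+1%:R^-1 => t1 t2 N1 N0.
  by rewrite ger0_norm; lra.
- apply: negligibleU; first exact: depth_negligible.
  apply: negligible_exists => h; have [->|he] := eqVneq h e.
    by apply: negligibleS (negligible_set0 _) => x /= [].
  by apply: negligibleS (edge_negligible hOmega he) => x /= [].
move=> x /not_orP[xm1 xe].
have [ux|ux] := pselect (unit_layer (nrm e) (b e) x); last first.
  rewrite /P; apply: cvg_near_cst; apply: nearW => N.
  rewrite indicE memNset // mul0r /patch memNset // => -[/andP[s0 s1] _].
  apply: ux; rewrite /unit_layer /= s0 /= lt_neqAle s1 andbT.
  by apply/eqP => s; apply: xm1; rewrite /= -[depth e x]opprK /depth opprB s.
have uxE : \1_(unit_layer (nrm e) (b e)) x = 1 :> R by rewrite indicE mem_set.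
have /choice[t tP] : forall N, exists t, pull_back (nrm e) (b e) N x = foot e x + t *: nrm e /\
    - (2 * N.+1%:R^-1) <= t < - N.+1%:R^-1.
  by move=> N; have [t] := pull_back_foot N ux; exists t.
have t0 : t N @[N --> \oo] --> 0.
  have h2 : - 2 * harmonic N @[N --> \oo] --> (- 2 * 0 : R).
    by apply: cvgM; [exact: cvg_cst|exact: cvg_harmonic].
  rewrite mulr0 in h2.
  apply: (@squeeze_cvgr _ _ _ _ (fun N => - 2 * harmonic N) (cst 0)).
  - apply: nearW => N; have [_ /andP[h1 h]] := tP N; rewrite mulNr h1 /=.
    by rewrite (le_trans (ltW h)) // oppr_le0 invr_ge0.
  - exact: h2.
  - exact: cvg_cst.
under eq_cvg do rewrite /P uxE mul1r (tP _).1.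
have cx : foot e x + t N *: nrm e @[N --> \oo] --> foot e x by exact: cvg_line.
have cdepth h : depth h (foot e x + t N *: nrm e) @[N --> \oo] --> depth h (foot e x).
  by apply: continuous_cvg cx; exact: continuous_depth.
have [Oy|Oy] := pselect (Omega (foot e x)); last first.
  have -> : ((fun x => q (foot e x)) \_ (prism nrm b e)) x = 0.
    by rewrite /patch memNset // => -[_ []].
  have /existsNP[h /negP] : ~ forall h, 0 <= depth h (foot e x).
    by move=> /polytopeE.
  rewrite -ltNge => h0; apply: cvg_near_cst.
  have := cdepth h => /cvgr_lt /(_ 0 h0); apply: filterS => N hN.
  rewrite /Q /patch memNset ?mul0r // => /polytopeE /(_ h).
  by rewrite leNgt hN.
have -> : ((fun x => q (foot e x)) \_ (prism nrm b e)) x = q (foot e x).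
  rewrite /patch mem_set //; split; last exact/facet_foot.
  by case/andP: ux => -> /ltW.
have nearE : \forall N \near \oo,
    facet_layer e N.+1%:R^-1 (foot e x + t N *: nrm e).
  have nearh : \forall N \near \oo, forall h, h != e ->
      depth e (foot e x + t N *: nrm e) < depth h (foot e x + t N *: nrm e).
    apply: (@filter_forall _ _ (fun h N => h != e ->
      depth e (foot e x + t N *: nrm e) < depth h (foot e x + t N *: nrm e)) \oo) => h.
    have [->|he] := eqVneq h e; first exact: nearW.
    have h0 : 0 < depth h (foot e x) - depth e (foot e x).
      rewrite (depth_foot hOmega) subr0 lt_neqAle (polytopeE _ _ _).1 // andbT.
      by apply/eqP => hh; apply: xe; exists h.
    have : depth h (foot e x + t N *: nrm e) - depth e (foot e x + t N *: nrm e)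
        @[N --> \oo] --> depth h (foot e x) - depth e (foot e x).
      by apply: cvgB; exact: cdepth.
    move=> /cvgr_gt /(_ 0 h0).
    by apply: filterS => N; rewrite subr_gt0.
  apply: filterS nearh => N hN; split => //.
  have [_ /andP[t1 t2]] := tP N.
  rewrite depthD (depth_foot hOmega) sub0r dotZr nrm1 mulr1.
  by rewrite ltrNr t2 lerNl.
apply: (@cvg_trans _ (q (foot e x + t N *: nrm e) @[N --> \oo])).
  apply: near_eq_cvg; apply: filterS nearE => N hN.
  rewrite /Q indicE mem_set // mulr1 /patch mem_set //.
  by apply: facet_layer_polytope hN; rewrite invr_gt0.
have /(_ _ Oy) qy := (subspace_continuousP _ _).1 cq.
apply: cvg_comp qy => A /cx hA.
apply: filterS2 nearE hA => N hN; apply.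
by apply: facet_layer_polytope hN; rewrite invr_gt0.
Qed.

End facet_limit.

(** * The cutoff function *)

Section cutoff.
Context {R : realType} {d : nat}.
Variables (Nf : nat) (nrm : 'I_Nf -> 'rV[R]_d) (b : 'I_Nf -> R).
Hypothesis hOmega : is_polytope nrm b.
Variable eps : R.
Hypothesis eps0 : 0 < eps.
Local Notation lam := (lebesgue_rV R d).
Local Notation Omega := (polytope nrm b).
Local Notation depth := (depth nrm b).
Local Notation facet_layer := (facet_layer nrm b).

(** Piecewise affine in [x]: 0 where some depth is at most [eps], 1 where all
    depths are at least [2 * eps], and in between the slope is that of the
    smallest depth. It is a Lipschitz function supported inside the polytope. *)
Definition cutoff (x : 'rV[R]_d) : R :=
  Num.max 0 (\big[Num.min/1]_(e < Nf) (depth e x / eps - 1)).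

Lemma cutoff_ge0 x : 0 <= cutoff x.
Proof. by rewrite /cutoff le_max lexx. Qed.

Lemma cutoff_le1 x : cutoff x <= 1.
Proof. by rewrite /cutoff ge_max ler01 bigmin_le_id. Qed.

Lemma cutoff_support x : cutoff x != 0 -> forall e, eps < depth e x.
Proof.
move=> x0 e; rewrite ltNge; apply: contra x0 => xe.
rewrite /cutoff eq_le le_max lexx andbT ge_max lexx /=.
by apply: (bigmin_inf e) => //; rewrite subr_le0 ler_pdivrMr // mul1r.
Qed.

Lemma cutoff_le x y c : 0 <= c -> (forall e, depth e x <= depth e y + c) ->
  cutoff x <= cutoff y + c / eps.
Proof.
move=> c0 xy; have ce0 : 0 <= c / eps by rewrite divr_ge0 // ltW.
rewrite {1}/cutoff ge_max addr_ge0 ?cutoff_ge0 //=.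
rewrite -lerBlDr /cutoff le_max; apply/orP; right.
apply/bigmin_geP; split; first by rewrite lerBlDr (le_trans (bigmin_le_id _ _ _ _)) // lerDl.
move=> e _; rewrite lerBlDr; apply: (bigmin_inf e) => //.
by rewrite addrAC lerB // -mulrDl ler_pM2r ?invr_gt0.
Qed.

Lemma cutoff_lipschitz k t x :
  `|cutoff (x + t *: delta_mx ord0 k) - cutoff x| <= `|t| / eps.
Proof.
rewrite ler_norml lerBlDl lerBrDl lerBlDr; apply/andP; split.
  by apply: cutoff_le => // e; rewrite -lerBlDr; exact: depth_ge.
by apply: cutoff_le => // e; exact: depth_le.
Qed.

Lemma continuous_cutoff : continuous cutoff.
Proof.
have cd e : continuous (fun x => depth e x / eps - 1).
  move=> x; apply: (@continuousB _ _ _ (fun y => depth e y / eps) (cst 1)).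
    by apply: (@continuousM _ _ (depth e) (cst eps^-1));
      [exact: continuous_depth|exact: cst_continuous].
  exact: cst_continuous.
move=> x; apply: continuous_max; first exact: cst_continuous.
by apply: continuous_big => [|e _]; [exact: min_continuous|exact: cd].
Qed.

Lemma cutoff_deep x : (forall e, 2 * eps <= depth e x) -> cutoff x = 1.
Proof.
move=> xe; apply/eqP; rewrite eq_le cutoff_le1 /cutoff le_max; apply/orP; right.
apply/bigmin_geP; split => // e _.
by rewrite lerBrDr ler_pdivlMr // -[1 + 1]/2 xe.
Qed.

Lemma cutoff_layer e x : facet_layer e eps x -> cutoff x = depth e x / eps - 1.
Proof.
move=> [/andP[xe xe2] xh]; have x0 : 0 <= depth e x / eps - 1.
  by rewrite subr_ge0 ler_pdivlMr // mul1r ltW.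
rewrite /cutoff (_ : bigop _ _ _ = depth e x / eps - 1); first exact/max_idPr.
apply/eqP; rewrite eq_le (bigmin_inf e) //=; apply/bigmin_geP; split.
  by rewrite lerBlDr ler_pdivrMr // -[1 + 1]/2.
move=> h _; rewrite lerD2r ler_pM2r ?invr_gt0 //.
by have [->//|/xh/ltW] := eqVneq h e.
Qed.

(** The negligible set off which the cutoff is locally affine. *)
Definition kinks : set 'rV[R]_d :=
  [set x | exists e, depth e x = eps] `|` [set x | exists e, depth e x = 2 * eps]
  `|` [set x | exists eh : 'I_Nf * 'I_Nf, eh.1 != eh.2 /\ depth eh.1 x = depth eh.2 x].

Lemma kinks_negligible : lam.-negligible kinks.
Proof.
apply: negligibleU; [apply: negligibleU|].
- by apply: negligible_exists => e; exact: depth_negligible.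
- by apply: negligible_exists => e; exact: depth_negligible.
apply: negligible_exists => -[e h] /=.
have [->|eh] := eqVneq e h.
  by apply: negligibleS (negligible_set0 _) => x /= [].
by apply: negligibleS (tie_negligible hOmega eh) => x /= [].
Qed.

(** Off the kinks the cutoff is affine near [x]: constant, or a function of the
    depth of the one facet whose layer contains [x]. *)
Lemma cutoff_quotient_cvg k (t : nat -> R) x : (forall j, t j != 0) ->
  t j @[j --> \oo] --> 0 -> ~ kinks x ->
  (cutoff (x + t j *: delta_mx ord0 k) - cutoff x) / t j @[j --> \oo] -->
  - \sum_e nrm e ord0 k / eps * \1_(facet_layer e eps) x.
Proof.
move=> tn0 t0 /not_orP[/not_orP[/forallNP x1 /forallNP x2] /forallNP xt].
pose y j := x + t j *: delta_mx ord0 k.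
have cd e : depth e (y j) @[j --> \oo] --> depth e x.
  by apply: continuous_cvg; [exact: continuous_depth|exact: cvg_line].
have [[e xe]|/forallNP xe] := pselect (exists e, depth e x < eps).
  rewrite big1 ?oppr0 => [|h _]; last first.
    rewrite indicE memNset ?mulr0 // => -[/andP[he _] heh].
    have [E|/heh] := eqVneq e h; first by move: he; rewrite -E ltNge (ltW xe).
    by move=> /(lt_trans he)/(lt_trans xe); rewrite ltxx.
  apply: cvg_near_cst; have /cvgr_lt /(_ _ xe) := cd e; apply: filterS => j je.
  have zero z : depth e z < eps -> cutoff z = 0.
    by move=> ze; apply/eqP; apply: contraTT ze => /cutoff_support/(_ e)/ltW; rewrite leNgt.
  by rewrite !zero // subrr mul0r.
have xgt e : eps < depth e x.
  rewrite lt_neqAle leNgt; apply/andP; split; last exact/negP.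
  by rewrite eq_sym; apply/eqP/x1.
have [[e1 xe1]|/forallNP xd] := pselect (exists e, depth e x < 2 * eps); last first.
  have xgt2 e : 2 * eps < depth e x.
    rewrite lt_neqAle leNgt; apply/andP; split; last exact/negP.
    by rewrite eq_sym; apply/eqP/x2.
  rewrite big1 ?oppr0 => [|h _]; last first.
    by rewrite indicE memNset ?mulr0 // => -[/andP[_]]; rewrite leNgt xgt2.
  have near2 : \forall j \near \oo, forall e, 2 * eps < depth e (y j).
    apply: (@filter_forall _ _ (fun e j => 2 * eps < depth e (y j)) \oo) => e.
    by have /cvgr_gt /(_ _ (xgt2 e)) := cd e.
  apply: cvg_near_cst; apply: filterS near2 => j jd.
  rewrite !cutoff_deep ?subrr ?mul0r // => e; [exact/ltW/xgt2|exact/ltW/jd].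
have [e _ emin] := @arg_minP _ _ _ e1 xpredT (fun e => depth e x) isT.
have xe2 : depth e x < 2 * eps by apply: le_lt_trans xe1; exact: emin.
have xh h : h != e -> depth e x < depth h x.
  move=> he; rewrite lt_neqAle emin // andbT; apply/eqP => E.
  by apply: (xt (e, h)); rewrite /= eq_sym he.
have Lx : facet_layer e eps x by split => //; rewrite xgt ltW.
rewrite (bigD1 e) //= big1 ?addr0 => [|h he]; last first.
  rewrite indicE memNset ?mulr0 // => -[_] /(_ e).
  by rewrite eq_sym he => /(_ isT); rewrite ltNge ltW // xh.
rewrite indicE mem_set // mulr1.
have nearL : \forall j \near \oo, facet_layer e eps (y j).
  have nearh : \forall j \near \oo, forall h, h != e -> depth e (y j) < depth h (y j).
    apply: (@filter_forall _ _ (fun h j => h != e -> depth e (y j) < depth h (y j)) \oo) => h.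
    have [->|he] := eqVneq h e; first exact: nearW.
    have h0 : 0 < depth h x - depth e x by rewrite subr_gt0 xh.
    have : depth h (y j) - depth e (y j) @[j --> \oo] --> depth h x - depth e x.
      by apply: cvgB; exact: cd.
    by move=> /cvgr_gt /(_ 0 h0); apply: filterS => N; rewrite subr_gt0.
  have /cvgr_gt /(_ _ (xgt e)) := cd e; have /cvgr_lt /(_ _ xe2) := cd e.
  by apply: filterS3 nearh => j jh j1 j2; split => //; rewrite j2 ltW.
apply: cvg_near_cst; apply: filterS nearL => j jL.
rewrite (cutoff_layer jL) (cutoff_layer Lx) opprB addrA subrK -mulrBl.
rewrite depthD dotZr dot_delta addrAC subrr add0r.
by field; rewrite tn0 gt_eqF.
Qed.

End cutoff.

(** * Integration by parts against the cutoff *)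

Section by_parts.
Context {R : realType} {d : nat}.

Lemma is_derive_line (f : 'rV[R]_d -> R) (x v : 'rV[R]_d) (s : R) :
  derivable f (x + s *: v) v ->
  is_derive s 1 (fun s => f (x + s *: v)) ('D_v f (x + s *: v)).
Proof.
have E : (fun h : R => h^-1 *: (((fun s => f (x + s *: v)) \o shift s) (h *: 1) -
      f (x + s *: v))) =
    (fun h => h^-1 *: ((f \o shift (x + s *: v)) (h *: v) - f (x + s *: v))).
  apply/funext => h /=; congr (_ *: (f _ - _)).
  by rewrite [_%:A]mulr1 scalerDl addrCA.
by move=> df; split; rewrite /derivable /derive E.
Qed.

Lemma derive_quotient_cvg (f : 'rV[R]_d -> R) (x v : 'rV[R]_d) (t : nat -> R) :
  derivable f x v -> (forall j, t j != 0) -> t j @[j --> \oo] --> 0 ->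
  (f (x + t j *: v) - f x) / t j @[j --> \oo] --> 'D_v f x.
Proof.
move=> df tn0 t0.
have td : t j @[j --> \oo] --> 0^'.
  move=> A /t0 tA.
  apply: (@filterS _ \oo _ (fun j => t j != 0 -> A (t j))); last exact: tA.
  by move=> j; apply; exact: tn0.
have h := cvg_comp _ _ td df.
apply: cvg_trans h; apply: near_eq_cvg; apply: nearW => j /=.
by rewrite [x + _]addrC mulrC.
Qed.

Variables (Nf : nat) (nrm : 'I_Nf -> 'rV[R]_d) (b : 'I_Nf -> R).
Hypothesis hOmega : is_polytope nrm b.
Variable eps : R.
Hypothesis eps0 : 0 < eps.
Local Notation lam := (lebesgue_rV R d).
Local Notation Omega := (polytope nrm b).
Local Notation depth := (depth nrm b).
Local Notation cutoff := (cutoff nrm b eps).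
Variables (k : 'I_d) (f : 'rV[R]_d -> R).
Hypothesis cf : {within Omega, continuous f}.
Hypothesis df : forall x, Omega° x -> derivable f x (delta_mx ord0 k).
Hypothesis cdf : forall x, Omega° x -> {for x, continuous (partial k f)}.
Local Notation dk := (delta_mx ord0 k).

Let K := deeper nrm b (eps / 2).
Let F := f \_ Omega.
Let g := partial k f \_ K.

Let eps20 : 0 < eps / 2. Proof. by rewrite divr_gt0. Qed.

Let KO : K `<=` Omega°. Proof. exact: deeper_interior. Qed.

Let tF : tame F.
Proof. by apply: tame_restrict_compact => //; exact: compact_polytope. Qed.

Let tg : tame g.
Proof.
apply: tame_restrict_compact; first by apply: compact_deeper => //; exact: ltW.
by apply: continuous_in_subspaceT => x; rewrite inE => /KO; exact: cdf.
Qed.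

Lemma bdd_meas_cutoff : bdd_meas cutoff.
Proof.
split; first by apply: continuous_rV_measurable; exact: continuous_cutoff.
by exists 1 => x; rewrite ger0_norm ?cutoff_ge0 // cutoff_le1.
Qed.

Lemma cutoff_partial x : cutoff x * partial k f x = cutoff x * g x.
Proof.
have [->|/(cutoff_support eps0) xe] := eqVneq (cutoff x) 0; first by rewrite !mul0r.
congr (_ * _); rewrite /g /patch mem_set // => e.
by rewrite (le_trans _ (ltW (xe e))) // ler_pdivrMr // ler_peMr ?ltW // ltr1n.
Qed.

Lemma tame_cutoff_partial : tame (fun x => cutoff x * partial k f x).
Proof.
under eq_fun do rewrite cutoff_partial.
by apply: tameMl tg; exact: bdd_meas_cutoff.
Qed.

(** Where the cutoff is positive the whole segment stays at depth at least
    [eps / 2], inside the compact set [K] on which the partial derivative is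
    bounded; the mean value theorem then bounds the increment of [f]. *)
Let bound_increment M x t : (forall y, `|g y| <= M) -> 0 < t <= eps / 2 ->
  cutoff (x + t *: dk) != 0 -> `|F (x + t *: dk) - F x| <= M * t.
Proof.
move=> gM /andP[t0 te] /(cutoff_support eps0) xe.
have inK s : 0 <= s <= t -> K (x + s *: dk).
  move=> /andP[s0 st] e; have -> : x + s *: dk = x + t *: dk + (s - t) *: dk.
    by rewrite scalerBl addrA addrAC addrK.
  apply: le_trans (depth_ge hOmega _ _ _ _).
  rewrite distrC ger0_norm ?subr_ge0 //; have := xe e; lra.
have inO s : 0 <= s <= t -> F (x + s *: dk) = f (x + s *: dk).
  by move=> /inK/KO/interior_subset ?; rewrite /F /patch mem_set.
have -> : F x = f (x + 0 *: dk).
  by rewrite -inO ?scale0r ?addr0 // lexx ltW.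
rewrite inO; last by rewrite lexx ltW.
have dphi s : 0 <= s <= t -> is_derive s 1 (fun s => f (x + s *: dk))
    (partial k f (x + s *: dk)).
  by move=> /inK/KO/df; exact: is_derive_line.
have [] := @MVT_segment R (fun s => f (x + s *: dk))
    (fun s => partial k f (x + s *: dk)) 0 t (ltW t0).
- by move=> s; rewrite in_itv /= => /andP[s0 st]; apply: dphi; rewrite !ltW.
- apply: derivable_within_continuous => s; rewrite in_itv /= => /dphi h.
  exact: ex_derive.
move=> s; rewrite in_itv /= => sI ->; rewrite subr0 normrM (ger0_norm (ltW t0)).
apply: ler_wpM2r; first exact: ltW.
apply: le_trans (gM (x + s *: dk)).
by rewrite /g /patch mem_set //; exact: inK.
Qed.

(** The product of the cutoff and [f] has the same integral as its translate by
    [t j] in direction [k], so the integral of its difference quotient is 0. A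
    discrete Leibniz rule splits this quotient into a term [A] with the
    increment of [f] and a term [B] with the increment of the cutoff, and
    dominated convergence applies to each. *)
Lemma cutoff_by_parts :
  Int (fun x => cutoff x * partial k f x) =
  \sum_e nrm e ord0 k / eps * Int (fun x => F x * \1_(facet_layer nrm b e eps) x).
Proof.
(* Steps of at most [eps / 2] keep the segments used for the domination in [K]. *)
pose t (j : nat) : R := eps / 2 * harmonic j.
have t_gt0 j : 0 < t j by rewrite mulr_gt0 // harmonic_gt0.
have tn0 j : t j != 0 by rewrite gt_eqF.
have t_le j : t j <= eps / 2.
  apply: ler_piMr; first exact: ltW.
  by rewrite /harmonic /= invf_le1 // ler1n.
have t0 : t j @[j --> \oo] --> 0.
  have : t j @[j --> \oo] --> eps / 2 * 0.
    by apply: cvgM; [exact: cvg_cst|exact: cvg_harmonic].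
  by rewrite mulr0.
pose A j x := cutoff (x + t j *: dk) * ((F (x + t j *: dk) - F x) / t j).
pose B j x := F x * ((cutoff (x + t j *: dk) - cutoff x) / t j).
have bc := bdd_meas_cutoff.
have tA j : tame (A j).
  apply: tameMl; first exact: bdd_meas_shift.
  by apply: tameMr (bdd_meas_cst _); apply: tameB => //; exact: tame_shift.
have tB j : tame (B j).
  apply: tameMr => //; apply: bdd_measM (bdd_meas_cst _).
  apply: bdd_measD; first exact: bdd_meas_shift.
  under eq_fun do rewrite -mulN1r.
  by apply: bdd_measM => //; exact: bdd_meas_cst.
pose S x : R := \sum_e nrm e ord0 k / eps * \1_(facet_layer nrm b e eps) x.
have AB j : Int (A j) + Int (B j) = 0.
  have tcF : tame (fun x => cutoff x * F x) by exact: tameMl.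
  rewrite -IntD //.
  transitivity (Int (fun x => (t j)^-1 *
      (cutoff (x + t j *: dk) * F (x + t j *: dk) - cutoff x * F x))).
    by congr Int; apply/funext => x; rewrite /A /B; ring.
  rewrite IntZ; last by apply: tameB => //; exact: (tame_shift _ tcF).
  rewrite (@IntB _ _ (fun x => cutoff (x + t j *: dk) * F (x + t j *: dk))) //.
    by rewrite (Int_shift (t j *: dk) tcF) subrr mulr0.
  exact: (tame_shift _ tcF).
have mS : bdd_meas S.
  rewrite /S; elim: index_enum => [|e s IH].
    by under eq_fun do rewrite big_nil; exact: bdd_meas_cst.
  under eq_fun do rewrite big_cons; apply: bdd_measD => //.
  apply: bdd_measM; first exact: bdd_meas_cst.
  by apply: bdd_meas_indic; exact: measurable_facet_layer.
have [_ [M gM]] := tame_bdd tg.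
have [[mF [MF FM]] [r Fr]] := tF.
have M0 : 0 <= M by apply: le_trans (gM 0).
have [r2 r2P] : exists r2, forall x, Omega x -> `|x| <= r2.
  have [r2 [_ r2P]] := bounded_polytope hOmega.
  by exists (r2 + 1) => x; apply: r2P; rewrite ltrDl.
have supp0 e x : depth e x <= eps -> cutoff x = 0.
  move=> xe; apply/eqP; apply: contraTT xe => /(cutoff_support eps0)/(_ e).
  by rewrite -ltNge.
have cA : Int (A j) @[j --> \oo] --> Int (fun x => cutoff x * partial k f x).
  apply: (@Int_cvg _ _ A _ set0 M (r2 + eps / 2 * `|dk : 'rV[R]_d|)).
  - by move=> j; case: (tA j) => -[].
  - by case: tame_cutoff_partial => -[].
  - move=> j x; rewrite /A; set y := x + _.
    have [->|y0] := eqVneq (cutoff y) 0; first by rewrite mul0r normr0.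
    rewrite normrM -[leRHS]mul1r ler_pM //.
      by rewrite ger0_norm ?cutoff_ge0 // cutoff_le1.
    rewrite normrM normfV (gtr0_norm (t_gt0 j)) ler_pdivrMr //.
    by apply: bound_increment => //; rewrite t_gt0 t_le.
  - move=> j x; rewrite /A; set y := x + _ => Ax.
    have y0 : cutoff y != 0 by apply: contraNneq Ax => ->; rewrite mul0r.
    rewrite (_ : x = y - t j *: dk); last by rewrite /y addrK.
    apply: (le_trans (ler_normB _ _)); apply: lerD.
      apply: r2P; apply/polytopeE => e; apply: ltW; apply: lt_trans eps0 _.
      exact: cutoff_support.
    by rewrite normrZ (gtr0_norm (t_gt0 j)); apply: ler_wpM2r.
  - exact: negligible_set0.
  - move=> x _; have [xp|/existsNP[e /negP]] := pselect (forall e, 0 < depth e x).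
      have xO := pos_depth_interior xp.
      apply: cvgM.
        by apply: continuous_cvg; [exact: continuous_cutoff|exact: cvg_line].
      apply: cvg_trans (derive_quotient_cvg (df xO) tn0 t0).
      apply: near_eq_cvg; apply: (@filterS _ \oo _ (fun j => Omega (x + t j *: dk))).
        move=> j jO; rewrite /F /patch !mem_set //.
        exact: (interior_subset xO).
      have h : x + t j *: dk @[j --> \oo] --> x by exact: cvg_line.
      exact: (h _ xO).
    rewrite -leNgt => xe; rewrite (@supp0 e) ?mul0r; last by rewrite (le_trans xe) ?ltW.
    apply: cvg_near_cst; apply: nearW => j; rewrite /A (@supp0 e) ?mul0r //.
    apply: le_trans (depth_le hOmega _ _ _ _) _.
    rewrite (gtr0_norm (t_gt0 j)); apply: (@le_trans _ _ (0 + eps / 2)).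
      by apply: lerD.
    by rewrite add0r ler_pdivrMr // ler_peMr ?ler1n // ltW.
have cB : Int (B j) @[j --> \oo] --> Int (fun x => F x * - S x).
  apply: (@Int_cvg _ _ B _ (kinks nrm b eps) (MF * eps^-1) r).
  - by move=> j; case: (tB j) => -[].
  - apply: measurable_funM => //; under eq_fun do rewrite -mulN1r.
    by apply: measurable_funM => //; case: mS.
  - move=> j x; rewrite /B normrM ler_pM // normrM normfV (gtr0_norm (t_gt0 j)).
    rewrite ler_pdivrMr // mulrC -[X in _ <= X * _](gtr0_norm (t_gt0 j)).
    exact: cutoff_lipschitz.
  - by move=> j x Bx; apply: Fr; apply: contraNneq Bx; rewrite /B => ->; rewrite mul0r.
  - exact: kinks_negligible.
  - move=> x nx; apply: cvgM; first exact: cvg_cst.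
    exact: cutoff_quotient_cvg.
have cAB : Int (A j) + Int (B j) @[j --> \oo] -->
    Int (fun x => cutoff x * partial k f x) + Int (fun x => F x * - S x).
  exact: cvgD.
have c0 : Int (A j) + Int (B j) @[j --> \oo] --> (0 : R).
  by apply: cvg_near_cst; exact: nearW.
have sum0 : Int (fun x => cutoff x * partial k f x) + Int (fun x => F x * - S x) = 0.
  exact: (cvg_unique _ cAB c0).
rewrite (eqP (etrans (esym (addr_eq0 _ _)) (introT eqP sum0))).
rewrite -[LHS]mulN1r -IntZ; last first.
  apply: tameMr => //; under eq_fun do rewrite -mulN1r.
  by apply: bdd_measM => //; exact: bdd_meas_cst.
transitivity (Int (fun x => \sum_e nrm e ord0 k / eps *
    (F x * \1_(facet_layer nrm b e eps) x))).
  congr Int; apply/funext => x; rewrite mulrN mulN1r opprK /S mulr_sumr.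
  by apply: eq_bigr => e _; rewrite mulrCA.
have tL e : tame (fun x => F x * \1_(facet_layer nrm b e eps) x).
  by apply: tameMr => //; apply: bdd_meas_indic; exact: measurable_facet_layer.
rewrite Int_sum => [|e _]; last exact: tameZ.
by apply: eq_bigr => e _; rewrite IntZ.
Qed.

End by_parts.

(** * The divergence theorem on a polytope *)

Section divergence.
Context {R : realType} {d : nat}.
Variables (Nf : nat) (nrm : 'I_Nf -> 'rV[R]_d) (b : 'I_Nf -> R).
Hypothesis hOmega : is_polytope nrm b.
Local Notation lam := (lebesgue_rV R d).
Local Notation Omega := (polytope nrm b).
Local Notation depth := (depth nrm b).

Lemma vol_intE f : vol_int nrm b f = Int (f \_ Omega).
Proof. by rewrite /vol_int /Int Rintegral_mkcond. Qed.

Lemma tame_within (f : 'rV[R]_d -> R) : {within Omega, continuous f} ->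
  tame (f \_ Omega).
Proof. by apply: tame_restrict_compact => //; exact: compact_polytope. Qed.

(** As the layers shrink, the cutoff tends to the indicator of the polytope off
    the hyperplanes of the facets. *)
Lemma cutoff_limit (f : 'rV[R]_d -> R) : {within Omega, continuous f} ->
  Int (fun x => cutoff nrm b N.+1%:R^-1 x * (f \_ Omega) x) @[N --> \oo] -->
  vol_int nrm b f.
Proof.
move=> /tame_within tf; rewrite vol_intE.
have [[mf [M fM]] [r fr]] := tf.
have N0 N : 0 < N.+1%:R^-1 :> R by rewrite invr_gt0.
apply: (@Int_cvg _ _ _ _ [set x | exists e, depth e x = 0] M r) => //.
- by move=> N; case: (tameMl (bdd_meas_cutoff nrm b N.+1%:R^-1) tf) => -[].
- move=> N x; rewrite normrM -[leRHS]mul1r ler_pM //.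
  by rewrite ger0_norm ?cutoff_ge0 // cutoff_le1.
- by move=> N x fx; apply: fr; apply: contraNneq fx => ->; rewrite mulr0.
- by apply: negligible_exists => e; exact: depth_negligible.
move=> x /forallNP xe; have [xO|xO] := pselect (Omega x); last first.
  rewrite /patch memNset //; under eq_cvg do rewrite mulr0; exact: cvg_cst.
apply: cvg_near_cst.
have : \forall N \near \oo, forall e, 2 * N.+1%:R^-1 <= depth e x.
  apply: (@filter_forall _ _ (fun e N => 2 * N.+1%:R^-1 <= depth e x) \oo) => e.
  have e0 : 0 < depth e x.
    by rewrite lt_neqAle eq_sym (polytopeE _ _ _).1 // andbT; apply/eqP/xe.
  have h2 : 2 * harmonic N @[N --> \oo] --> (2 * 0 : R).
    by apply: cvgM; [exact: cvg_cst|exact: cvg_harmonic].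
  rewrite mulr0 in h2; have /cvgr_lt /(_ _ e0) := h2.
  by apply: filterS => N /ltW.
by apply: filterS => N hN; rewrite cutoff_deep ?mul1r.
Qed.

(** Summed over the directions, [cutoff_by_parts] expresses the integral of the
    divergence against the cutoff as a sum over the facets of normalized
    integrals of the flux over [facet_layer]. Both sides converge as the layers
    shrink, by [cutoff_limit] and [facet_limit]. *)
Theorem divergence_polytope (G : 'rV[R]_d -> 'rV[R]_d) (D : 'rV[R]_d -> R) :
  (forall k, {within Omega, continuous (fun x => G x ord0 k)}) ->
  (forall k x, Omega° x ->
    derivable (fun y => G y ord0 k) x (delta_mx ord0 k)) ->
  (forall k x, Omega° x ->
    {for x, continuous (partial k (fun y => G y ord0 k))}) ->
  {within Omega, continuous D} ->
  (forall x, Omega° x -> D x = divergence G x) ->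
  vol_int nrm b D = \sum_e facet_int nrm b e (fun x => dot (G x) (nrm e)).
Proof.
move=> cG dG cdG cD DE.
have N0 N : 0 < N.+1%:R^-1 :> R by rewrite invr_gt0.
have cq e : {within Omega, continuous (fun x => dot (G x) (nrm e))}.
  apply/subspace_continuousP => x xO.
  apply: cvg_big => [|k _]; first exact: add_continuous.
  have /subspace_continuousP/(_ _ xO) h := cG k.
  by apply: cvgM; [exact: h|exact: cvg_cst].
apply: (cvg_unique _ (cutoff_limit cD)); first exact: Rhausdorff.
have E N : Int (fun x => cutoff nrm b N.+1%:R^-1 x * (D \_ Omega) x) =
   \sum_e N.+1%:R * Int (fun x => ((fun x => dot (G x) (nrm e)) \_ Omega) x *
      \1_(facet_layer nrm b e N.+1%:R^-1) x).
  transitivity (Int (fun x => \sum_k cutoff nrm b N.+1%:R^-1 x *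
      partial k (fun y => G y ord0 k) x)).
    congr Int; apply/funext => x.
    have [->|x0] := eqVneq (cutoff nrm b N.+1%:R^-1 x) 0.
      by rewrite mul0r big1 // => k _; rewrite mul0r.
    have xO : Omega° x.
      apply: pos_depth_interior => e; apply: lt_trans (N0 N) _.
      exact: cutoff_support.
    have xO' : Omega x by exact: interior_subset xO.
    rewrite /patch mem_set //.
    by rewrite DE // /divergence mulr_sumr.
  rewrite Int_sum => [|k _]; last first.
    by apply: tame_cutoff_partial => //; exact: cdG.
  under eq_bigr => k _ do rewrite (cutoff_by_parts hOmega (N0 N) (cG k)
    (dG k) (cdG k)).
  rewrite exchange_big /=; apply: eq_bigr => e _.
  have tL k : tame (fun x => ((fun y => G y ord0 k) \_ Omega) x *
      \1_(facet_layer nrm b e N.+1%:R^-1) x).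
    apply: tameMr; first exact: tame_within.
    by apply: bdd_meas_indic; exact: measurable_facet_layer.
  transitivity (N.+1%:R * \sum_k nrm e ord0 k * Int (fun x =>
      ((fun y => G y ord0 k) \_ Omega) x * \1_(facet_layer nrm b e N.+1%:R^-1) x)).
    rewrite mulr_sumr; apply: eq_bigr => k _.
    by rewrite invrK -mulrA mulrCA.
  congr (_ * _).
  under eq_bigr => k _ do rewrite -(IntZ _ (tL k)).
  rewrite -Int_sum => [|k _]; last exact: tameZ.
  congr Int; apply/funext => x; rewrite /patch.
  case: (x \in Omega); last first.
    by rewrite mul0r big1 // => k _; rewrite mulr0.
  by rewrite /dot mulr_suml; apply: eq_bigr => k _; rewrite mulrA (mulrC (nrm e ord0 k)).
rewrite /=; under eq_cvg do rewrite E.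
apply: cvg_big => [|e _]; first exact: add_continuous.
exact: facet_limit.
Qed.

End divergence.

(** * Integration by parts on a polytope *)

Section green.
Context {R : realType} {d : nat}.
Variables (Nf : nat) (nrm : 'I_Nf -> 'rV[R]_d) (b : 'I_Nf -> R).
Hypothesis hOmega : is_polytope nrm b.
Local Notation Omega := (polytope nrm b).

Lemma vol_intD (f g : 'rV[R]_d -> R) :
  {within Omega, continuous f} -> {within Omega, continuous g} ->
  vol_int nrm b (fun x => f x + g x) = vol_int nrm b f + vol_int nrm b g.
Proof.
move=> cf cg; rewrite !vol_intE -IntD; [|exact: tame_within..].
by congr Int; apply/funext => x; rewrite /patch; case: ifP => _; rewrite // addr0.
Qed.

Lemma vol_intZ c (f : 'rV[R]_d -> R) : {within Omega, continuous f} ->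
  vol_int nrm b (fun x => c * f x) = c * vol_int nrm b f.
Proof.
move=> cf; rewrite !vol_intE -IntZ; last exact: tame_within.
by congr Int; apply/funext => x; rewrite /patch; case: ifP => _; rewrite // mulr0.
Qed.

Lemma vol_int_sum (J : eqType) (s : seq J) (F : J -> 'rV[R]_d -> R) :
  (forall j, j \in s -> {within Omega, continuous (F j)}) ->
  vol_int nrm b (fun x => \sum_(j <- s) F j x) =
  \sum_(j <- s) vol_int nrm b (F j).
Proof.
move=> cF; rewrite vol_intE.
transitivity (Int (fun x => \sum_(j <- s | j \in s) (F j \_ Omega) x)).
  congr Int; apply/funext => x; rewrite /patch -big_seq; case: ifP => // _.
  by rewrite big1.
rewrite Int_sum => [|j js]; last by apply: tame_within => //; exact: cF.
by rewrite -big_seq; apply: eq_bigr => j _; rewrite vol_intE.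
Qed.

Lemma within_continuousM (f g : 'rV[R]_d -> R) :
  {within Omega, continuous f} -> {within Omega, continuous g} ->
  {within Omega, continuous (fun x => f x * g x)}.
Proof.
move=> /subspace_continuousP cf /subspace_continuousP cg.
by apply/subspace_continuousP => x xO; apply: cvgM; [exact: cf|exact: cg].
Qed.

Lemma within_continuousD (f g : 'rV[R]_d -> R) :
  {within Omega, continuous f} -> {within Omega, continuous g} ->
  {within Omega, continuous (fun x => f x + g x)}.
Proof.
move=> /subspace_continuousP cf /subspace_continuousP cg.
by apply/subspace_continuousP => x xO; apply: cvgD; [exact: cf|exact: cg].
Qed.

Lemma within_continuous_sum (J : Type) (s : seq J) (F : J -> 'rV[R]_d -> R) :
  (forall j, {within Omega, continuous (F j)}) ->
  {within Omega, continuous (fun x => \sum_(j <- s) F j x)}.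
Proof.
move=> cF; elim: s => [|j s IH].
  by under eq_fun do rewrite big_nil; move=> x; exact: cst_continuous.
by under eq_fun do rewrite big_cons; exact: within_continuousD.
Qed.

Lemma C1_field_coord (G : 'rV[R]_d -> 'rV[R]_d) k :
  C1_field Omega G -> {within Omega, continuous (fun x => G x ord0 k)}.
Proof.
move=> [/subspace_continuousP cG _ _]; apply/subspace_continuousP => x xO.
apply: (@cvg_comp _ _ _ G (fun y : 'rV[R]_d => y ord0 k) _ _ _ (cG x xO)).
exact: coord_continuous.
Qed.

Lemma C1_field_derivable (G : 'rV[R]_d -> 'rV[R]_d) k x v :
  C1_field Omega G -> Omega° x -> derivable (fun y => G y ord0 k) x v.
Proof.
move=> [_ dG _] /dG/(@diff_derivable _ _ _ _ _ v).
by move=> /derivable_mxP; apply.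
Qed.

Lemma for_continuous_near (f g : 'rV[R]_d -> R) (x : 'rV[R]_d) :
  {near nbhs x, f =1 g} -> {for x, continuous f} -> {for x, continuous g}.
Proof.
move=> fg cf; rewrite /prop_for /continuous_at -(nbhs_singleton fg).
exact: (cvg_trans (near_eq_cvg fg) cf).
Qed.

Lemma C1_field_partial (G : 'rV[R]_d -> 'rV[R]_d) k l x :
  C1_field Omega G -> Omega° x ->
  {for x, continuous (partial k (fun y => G y ord0 l))}.
Proof.
move=> [_ dG cdG] xO.
apply: (@for_continuous_near (fun y => ('D_(delta_mx ord0 k) G y) ord0 l)).
  have : nbhs x Omega° by exact: nbhs_interior.
  apply: filterS => y yO; rewrite derive_mx; last by apply: diff_derivable; exact: dG.
  by rewrite mxE.
apply: (@cvg_comp _ _ _ (fun y => 'D_(delta_mx ord0 k) G y)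
  (fun z : 'rV[R]_d => z ord0 l) _ _ _ (cdG k x xO)).
exact: coord_continuous.
Qed.

Lemma within_dot_gradient (G : 'rV[R]_d -> 'rV[R]_d) (v : 'rV[R]_d -> R) :
  C1_field Omega G -> (forall k, continuous (partial k v)) ->
  {within Omega, continuous (fun x => dot (G x) (gradient v x))}.
Proof.
move=> C1G cdv; apply: within_continuous_sum => k; apply: within_continuousM.
  exact: C1_field_coord.
rewrite (_ : (fun x => _) = partial k v); last by apply/funext => x; rewrite mxE.
exact: continuous_subspaceT.
Qed.

(** The divergence theorem for the field [v *: G], whose divergence is
    [v * H + dot G (gradient v)]. *)
Theorem green_polytope (G : 'rV[R]_d -> 'rV[R]_d) (v H : 'rV[R]_d -> R) :
  C1_field Omega G -> continuous H ->
  (forall x, Omega° x -> H x = divergence G x) ->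
  (forall x, differentiable v x) -> (forall k, continuous (partial k v)) ->
  vol_int nrm b (fun x => v x * H x) +
  vol_int nrm b (fun x => dot (G x) (gradient v x)) =
  \sum_e facet_int nrm b e (fun x => v x * dot (G x) (nrm e)).
Proof.
move=> C1G cH HE dv cdv.
have cv : continuous v by move=> x; apply: differentiable_continuous.
have wv : {within Omega, continuous v} by exact: continuous_subspaceT.
have cGv := within_dot_gradient C1G cdv.
have cvH : {within Omega, continuous (fun x => v x * H x)}.
  by apply: within_continuousM => //; exact: continuous_subspaceT.
rewrite -vol_intD //.
have vGE k : (fun x => (v x *: G x) ord0 k) = v * (fun x => G x ord0 k).
  by apply/funext => x; rewrite mxE.
have dGk k x : Omega° x -> derivable (fun y => G y ord0 k) x (delta_mx ord0 k).
  by move=> xO; exact: C1_field_derivable.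
have dvk k x : derivable v x (delta_mx ord0 k) by exact: diff_derivable.
have pE k x : Omega° x -> partial k (fun y => (v y *: G y) ord0 k) x =
    v x * partial k (fun y => G y ord0 k) x + G x ord0 k * partial k v x.
  by move=> xO; rewrite /partial vGE deriveM //; exact: dGk.
transitivity (\sum_e facet_int nrm b e (fun x => dot (v x *: G x) (nrm e))).
  apply: (divergence_polytope hOmega).
  - by move=> k; rewrite vGE; apply: within_continuousM => //; exact: C1_field_coord.
  - by move=> k x xO; rewrite vGE; apply: derivableM => //; exact: dGk.
  - move=> k x xO.
    apply: (@for_continuous_near (fun x => v x * partial k (fun y => G y ord0 k) x +
        G x ord0 k * partial k v x)).
      have : nbhs x Omega° by exact: nbhs_interior.
      by apply: filterS => y yO; rewrite pE.
    have cGx : {for x, continuous (fun y => G y ord0 k)}.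
      have [_ dG _] := C1G.
      apply: (@cvg_comp _ _ _ G (fun z : 'rV[R]_d => z ord0 k) _ _ _
        (differentiable_continuous (dG x xO))).
      exact: coord_continuous.
    apply: (@continuousD _ _ _ (fun y => v y * partial k (fun y => G y ord0 k) y)
      (fun y => G y ord0 k * partial k v y)).
      apply: (@continuousM _ _ v (partial k (fun y => G y ord0 k))); first exact: cv.
      exact: C1_field_partial.
    by apply: (@continuousM _ _ (fun y => G y ord0 k) (partial k v)) => //; exact: cdv.
  - exact: within_continuousD.
  - move=> x xO; rewrite HE // /divergence mulr_sumr -big_split /=.
    by apply: eq_bigr => k _; rewrite pE // mxE.
by apply: eq_bigr => e _; congr facet_int; apply/funext => x; rewrite dotZl.
Qed.

End green.

(** * Polynomials and their coefficient vectors *)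

Section polynomials.
Context {R : realType} {d : nat}.
Implicit Types (f v : 'rV[R]_d -> R) (Nset : {fset mindex d}).

Lemma monomial_differentiable (a : mindex d) (x : 'rV[R]_d) :
  differentiable (@monomial R d a) x.
Proof.
rewrite /monomial; elim: index_enum => [|k s IH].
  by under eq_fun do rewrite big_nil; exact: differentiable_cst.
under eq_fun do rewrite big_cons; apply: differentiableM => //.
elim: (a k) => [|m IHm].
  by under eq_fun do rewrite expr0; exact: differentiable_cst.
under eq_fun do rewrite exprS; apply: differentiableM => //.
exact: differentiable_coord.
Qed.

Lemma monomial_span_differentiable Nset v x :
  monomial_span Nset v -> differentiable v x.
Proof.
move=> [c ->]; elim: (enum_fset Nset) => [|a s IH].
  by under eq_fun do rewrite big_nil; exact: differentiable_cst.
under eq_fun do rewrite big_cons; apply: differentiableD => //.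
by apply: differentiableM => //; exact: monomial_differentiable.
Qed.

Lemma monomial_span_sum Nset n (c : 'I_n -> R) (phi : 'I_n -> 'rV[R]_d -> R) :
  (forall i, monomial_span Nset (phi i)) ->
  monomial_span Nset (fun y => \sum_i c i * phi i y).
Proof.
move=> /choice[e eP]; exists (fun a => \sum_i c i * e i a).
apply/funext => y; under [RHS]eq_bigr => a _ do rewrite mulr_suml.
rewrite exchange_big /=; apply: eq_bigr => i _.
by rewrite eP mulr_sumr; apply: eq_bigr => a _; rewrite mulrA.
Qed.

Definition lincomb n (phi : 'I_n -> 'rV[R]_d -> R) (c : 'cV[R]_n) : 'rV[R]_d -> R :=
  fun y => \sum_i c i ord0 * phi i y.

Lemma partial_lincomb n (phi : 'I_n -> 'rV[R]_d -> R) (D : 'M[R]_n) k c :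
  (forall i x, differentiable (phi i) x) ->
  (forall j, partial k (phi j) = fun y => \sum_i D i j * phi i y) ->
  partial k (lincomb phi c) = lincomb phi (D *m c).
Proof.
move=> dphi Dphi; apply/funext => x.
rewrite /partial.
have -> : lincomb phi c = \sum_i (c i ord0 \*: phi i).
  by apply/funext => y; rewrite fct_sumE.
have dd i : derivable (phi i) x (delta_mx ord0 k) by exact: diff_derivable.
rewrite derive_sum => [|i]; last exact: derivableZ.
under eq_bigr => i _ do rewrite deriveZ //.
transitivity (\sum_i \sum_j c i ord0 * (D j i * phi j x)).
  apply: eq_bigr => i _; have := congr1 (fun g => g x) (Dphi i).
  by rewrite /partial => ->; rewrite /GRing.scale /= mulr_sumr.
rewrite exchange_big /= /lincomb; apply: eq_bigr => j _.
by rewrite mxE mulr_suml; apply: eq_bigr => i _; rewrite mulrCA mulrA.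
Qed.

(** The order of the matrix powers in [D_mx] is the order in which [mpartial]
    nests the derivatives, so the matrices need not commute. *)
Lemma mpartial_lincomb n (phi : 'I_n -> 'rV[R]_d -> R) (D : 'I_d -> 'M[R]_n) a c :
  (forall i x, differentiable (phi i) x) ->
  (forall k j, partial k (phi j) = fun y => \sum_i D k i j * phi i y) ->
  mpartial a (lincomb phi c) = lincomb phi (D_mx D a *m c).
Proof.
move=> dphi Dphi; rewrite /mpartial /D_mx.
have -> : enum 'I_d = index_enum 'I_d by rewrite enumT /index_enum locked_withE.
elim: (index_enum _) => [|k s IH] /=; first by rewrite big_nil mul1mx.
rewrite IH big_cons -mulmxE -mulmxA; move: (_ *m c) => e.
elim: (a k) => [|m IHm] /=; first by rewrite expr0 mul1mx.
by rewrite IHm (@partial_lincomb _ _ (D k)) // mulmxA exprS mulmxE.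
Qed.

Lemma discrete_ip_lincomb n N (x : 'I_N -> 'rV[R]_d) (W : 'M[R]_N)
    (phi : 'I_n -> 'rV[R]_d -> R) (a c : 'cV[R]_n) :
  discrete_ip x W (lincomb phi a) (lincomb phi c) =
  (a^T *m mass_mx x W phi *m c) ord0 ord0.
Proof.
have vE e i : lincomb phi e (x i) = (vandermonde x phi *m e) i ord0.
  by rewrite mxE; apply: eq_bigr => j _; rewrite mxE mulrC.
rewrite /mass_mx !mulmxA -trmx_mul -mulmxA mxE /discrete_ip exchange_big /=.
apply: eq_bigr => j _; rewrite mxE mulr_suml; apply: eq_bigr => i _.
by rewrite !vE [in RHS]mxE.
Qed.

Lemma sym_posdef_unitmx n (A : 'M[R]_n) : sym_posdef A -> A \in unitmx.
Proof.
move=> [_ Apos]; apply: contraT; rewrite -row_free_unit -kermx_eq0 => kA.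
pose u := nz_row (kermx A).
have u0 : u != 0 by rewrite nz_row_eq0.
have uA : u *m A = 0 by apply/sub_kermxP; exact: nz_row_sub.
have := Apos u^T; rewrite trmx_eq0 => /(_ u0).
by rewrite trmxK uA mul0mx mxE ltxx.
Qed.

End polynomials.

(** * The lifting matrix *)

Theorem theorem3p1 (R : realType) (d : nat) (hd : (0 < d)%N)
  (* the reference polytope, its facets and outward unit normals *)
  (Nf : nat) (nrm : 'I_Nf -> 'rV[R]_d) (b : 'I_Nf -> R)
  (hOmega : is_polytope nrm b)
  (* the polynomial space V *)
  (p : nat) (Nset : {fset mindex d}) (Np : nat)
  (hNp : #|` Nset|%fset = Np)
  (hNset : forall a : mindex d, (mdegree a <= p)%N -> a \in Nset)
  (V : set ('rV[R]_d -> R)) (hV : V = monomial_span Nset)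
  (hVderiv : forall (k : 'I_d) (v : 'rV[R]_d -> R), V v -> V (partial k v))
  (hVcst : forall c : R, V (fun=> c))
  (* volume and facet nodes, and the matrices of the discrete inner products *)
  (N : nat) (hN : (Np <= N)%N)
  (x : 'I_N -> 'rV[R]_d) (hx : forall i, polytope nrm b (x i))
  (W : 'M[R]_N)
  (Nfac : 'I_Nf -> nat)
  (xf : forall g : 'I_Nf, 'I_(Nfac g) -> 'rV[R]_d)
  (hxf : forall (g : 'I_Nf) (i : 'I_(Nfac g)), facet nrm b g (xf g i))
  (Wf : forall g : 'I_Nf, 'M[R]_(Nfac g))
  (* coefficients *)
  (Mset : {fset mindex d}) (hMset : (Mset `<=` Nset)%fset)
  (C : mindex d -> R)
  (* correction functions G and their divergences H *)
  (G : forall g : 'I_Nf, 'I_(Nfac g) -> 'rV[R]_d -> 'rV[R]_d)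
  (H : forall g : 'I_Nf, 'I_(Nfac g) -> 'rV[R]_d -> R)
  (hGreg : forall (g : 'I_Nf) (j : 'I_(Nfac g)),
     C1_field (polytope nrm b) (G g j))
  (hH : forall (g : 'I_Nf) (j : 'I_(Nfac g)) (y : 'rV[R]_d),
     (polytope nrm b)° y -> H g j y = divergence (G g j) y)
  (hHV : forall (g : 'I_Nf) (j : 'I_(Nfac g)), V (H g j))
  (hGnodes : forall (g : 'I_Nf) (j : 'I_(Nfac g))
                    (e : 'I_Nf) (i : 'I_(Nfac e)),
     dot (G g j (xf e i)) (nrm e) = ((g == e) && (i == j :> nat))%:R)
  (hGint : forall (g : 'I_Nf) (j : 'I_(Nfac g)) (v : 'rV[R]_d -> R), V v ->
     vol_int nrm b (fun y =>
       dot (G g j y) (gradient v y)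
       - \sum_(a <- enum_fset Mset)
           C a / volume nrm b * mpartial a v y * mpartial a (H g j) y) = 0)
  (* an arbitrary basis of V and its differentiation matrices *)
  (phi : 'I_Np -> 'rV[R]_d -> R) (hphi : is_basis V phi)
  (D : 'I_d -> 'M[R]_Np)
  (hD : forall (k : 'I_d) (j : 'I_Np),
     partial k (phi j) = fun y => \sum_(i < Np) D k i j * phi i y)
  (* accuracy of the discrete inner products *)
  (hW : forall u v : 'rV[R]_d -> R, V u -> V v ->
     discrete_ip x W u v = vol_int nrm b (fun y => u y * v y))
  (hWf : forall (g : 'I_Nf) (u v : 'rV[R]_d -> R), V u -> V v ->
     discrete_ip (xf g) (Wf g) u v = facet_int nrm b g (fun y => u y * v y))
  (* the same accuracy with one argument a normal trace of G (automatic when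
     that trace is the restriction of an element of V) *)
  (hWfG : forall (g : 'I_Nf) (j : 'I_(Nfac g)) (e : 'I_Nf)
                 (v : 'rV[R]_d -> R), V v ->
     discrete_ip (xf e) (Wf e) v (fun y => dot (G g j y) (nrm e))
     = facet_int nrm b e (fun y => v y * dot (G g j y) (nrm e)))
  (hpos : sym_posdef (mass_mx x W phi
            + K_mx (volume nrm b) Mset C (mass_mx x W phi) D)) :
  forall (g : 'I_Nf) (j : 'I_(Nfac g)) (y : 'rV[R]_d), polytope nrm b y ->
    H g j y =
    \sum_(i < Np)
      (invmx (mass_mx x W phi
              + K_mx (volume nrm b) Mset C (mass_mx x W phi) D)
       *m (vandermonde (xf g) phi)^T *m Wf g) i j * phi i y.
Proof.
set M := mass_mx x W phi; set vol := volume nrm b.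
set K := K_mx vol Mset C M D.
move=> g j.
have Vdiff v : V v -> forall y, differentiable v y.
  by rewrite hV => Vv y; exact: monomial_span_differentiable Vv.
have Vcont v : V v -> continuous v.
  by move=> /Vdiff dv y; exact: differentiable_continuous.
have Vwithin v : V v -> {within polytope nrm b, continuous v}.
  by move=> /Vcont; exact: continuous_subspaceT.
have Vmpartial a v : V v -> V (mpartial a v).
  move=> Vv; rewrite /mpartial; elim: (enum _) => //= k s IH.
  by elim: (a k) => //= m; exact: hVderiv.
have [Vphi _ phi_span] := hphi.
have Vlin e : V (lincomb phi e).
  by rewrite hV; apply: monomial_span_sum => i; rewrite -hV; exact: Vphi.
have phidiff i y : differentiable (phi i) y by exact: Vdiff.
have mplin a e : mpartial a (lincomb phi e) = lincomb phi (D_mx D a *m e).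
  exact: mpartial_lincomb.
have [h0 Hh0] := phi_span _ (hHV g j).
pose h : 'cV[R]_Np := \col_i h0 i.
have HE : H g j = lincomb phi h.
  by rewrite Hh0; apply/funext => y; apply: eq_bigr => i _; rewrite mxE.
(* The nodal conditions leave only facet [g], and there only column [j]. *)
have bdry (e : 'cV[R]_Np) : \sum_g' facet_int nrm b g' (fun y => lincomb phi e y *
      dot (G g j y) (nrm g')) =
    (e^T *m ((vandermonde (xf g) phi)^T *m Wf g)) ord0 j.
  under eq_bigr => g' _ do rewrite -hWfG //.
  rewrite (bigD1 g) //= [X in _ + X]big1 ?addr0 => [|g' gg']; last first.
    rewrite /discrete_ip big1 // => i _; rewrite big1 // => i' _.
    by rewrite hGnodes eq_sym (negbTE gg') mulr0.
  rewrite mulmxA -trmx_mul mxE; apply: eq_bigr => i _.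
  rewrite (bigD1 j) //= big1 ?addr0 => [|i' ij]; last first.
    by rewrite hGnodes eqxx /= (inj_eq val_inj) (negbTE ij) mulr0.
  rewrite hGnodes !eqxx mulr1 !mxE; congr (_ * _).
  by apply: eq_bigr => l _; rewrite mxE mulrC.
(* The identity of bilinear forms: the first summand is [M], and the stationarity
   condition on [G g j] turns the volume term with the gradient into [K]. *)
have key (e : 'cV[R]_Np) : (e^T *m (M + K) *m h) ord0 ord0 =
    (e^T *m ((vandermonde (xf g) phi)^T *m Wf g)) ord0 j.
  rewrite -bdry -(green_polytope hOmega (hGreg g j) (Vcont _ (hHV g j)) (hH g j)
    (Vdiff _ (Vlin e)) (fun k => Vcont _ (hVderiv k _ (Vlin e)))).
  rewrite mulmxDr mulmxDl mxE; congr (_ + _).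
    by rewrite -hW // HE discrete_ip_lincomb.
  have cA := within_dot_gradient (hGreg g j)
    (fun k => Vcont _ (hVderiv k _ (Vlin e))).
  pose T a y := mpartial a (lincomb phi e) y * mpartial a (H g j) y.
  have cT a : {within polytope nrm b, continuous (T a)}.
    by apply: within_continuousM; apply: Vwithin; exact: Vmpartial.
  have TE a : vol_int nrm b (T a) = ((D_mx D a *m e)^T *m M *m (D_mx D a *m h)) ord0 ord0.
    by rewrite -hW ?HE ?mplin ?discrete_ip_lincomb //; exact: Vmpartial.
  have cS : {within polytope nrm b, continuous
      (fun y => \sum_(a <- enum_fset Mset) C a / vol * T a y)}.
    apply: within_continuous_sum => a; apply: within_continuousM => //.
    by move=> y; exact: cst_continuous.
  have := hGint g j _ (Vlin e).
  have -> : (fun y => dot (G g j y) (gradient (lincomb phi e) y) -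
       \sum_(a <- enum_fset Mset) C a / volume nrm b *
          mpartial a (lincomb phi e) y * mpartial a (H g j) y) =
     (fun y => dot (G g j y) (gradient (lincomb phi e) y) +
        (- 1) * \sum_(a <- enum_fset Mset) C a / vol * T a y).
    apply/funext => y; rewrite mulN1r; congr (_ - _).
    by apply: eq_bigr => a _; rewrite /T mulrA.
  rewrite (vol_intD hOmega cA); last first.
    by apply: within_continuousM => // y; exact: cst_continuous.
  rewrite (vol_intZ hOmega _ cS) mulN1r => /eqP; rewrite subr_eq0 => /eqP ->.
  rewrite (vol_int_sum hOmega) => [|a _]; last first.
    by apply: within_continuousM => // y; exact: cst_continuous.
  rewrite /K /K_mx mulmx_sumr mulmx_suml summxE; apply: eq_bigr => a _.
  rewrite (vol_intZ hOmega) // TE -scalemxAr -scalemxAl mxE; congr (_ * _).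
  by rewrite trmx_mul !mulmxA.
have hE : h = invmx (M + K) *m col j ((vandermonde (xf g) phi)^T *m Wf g).
  have Au := sym_posdef_unitmx hpos.
  rewrite -[LHS](mulKmx Au); congr (_ *m _); apply/colP => i.
  have := key (delta_mx i ord0).
  by rewrite trmx_delta -[in LHS]mulmxA -!rowE !mxE.
move=> y _; rewrite HE /lincomb hE; apply: eq_bigr => i _; congr (_ * _).
by rewrite -mulmxA [RHS]mxE mxE; apply: eq_bigr => l _; rewrite [in LHS]mxE.
Qed.
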